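(* Let $a\in\mathbb{R}$ and $\lambda>0$, and for $k=0,1,2,\ldots$ let $\psi_k$ be the eigenfunction of the eigenvalue problem $$-\psi''(x)+\Big(ax^2+\frac{\lambda}{2}x^4\Big)\psi(x)=E\psi(x),\quad x\in\mathbb{R},\qquad \lim_{x\to\pm\infty}\psi(x)=0,$$ belonging to the $k$-th eigenvalue $E_k$ (where $E_0<E_1<\cdots$), normalised by $$\psi_k(x)\sim x^{-1}\exp\Big(-\frac{(\lambda/2)^{1/2}}{3}x^3-\frac{a}{2(\lambda/2)^{1/2}}x\Big),\quad x\to+\infty.$$ Define $$\mathcal{K}(a,\lambda;x,y,z)=\lambda^{1/3}\exp\big((\lambda/2)^{1/2}xyz\big)\,\mathrm{Ai}\Big(\frac{\lambda^{1/3}}{2}(x^2+y^2+z^2)+\frac{a}{\lambda^{2/3}}\Big).$$ Then for every $k=0,1,2,\ldots$ and all $x,y\in\mathbb{R}$, $$\psi_k(x)\psi_k(y)=\int_{\mathbb{R}}\psi_k(z)\,\mathcal{K}(a,\lambda;x,y,z)\,dz.$$ Moreover, if $a>\lambda^{2/3}a_1$, where $a_1=-2.3381074105\ldots$ is the first (largest) zero of $\mathrm{Ai}$, then $\mathcal{K}(a,\lambda;x,y,z)>0$ for all $x,y,z\in\mathbb{R}$.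
   Context: $\mathrm{Ai}$ denotes the standard Airy function, the solution of $w''(x)=xw(x)$ given by $\mathrm{Ai}(x)=\frac{1}{2\pi i}\int_{\infty e^{-i\pi/3}}^{\infty e^{i\pi/3}}\exp(\zeta^3/3-\zeta x)\,d\zeta$. The eigenvalue problem stated has a discrete spectrum of real simple eigenvalues $E_0<E_1<\cdots\to\infty$; for each $E_k$ there is a unique solution with the stated asymptotic behaviour as $x\to+\infty$ (its derivative having the asymptotics given by differentiating the right-hand side), and this is $\psi_k$. *)

(* Defs.v *)
From HB Require Import structures.
From mathcomp Require Import all_boot all_order all_algebra.
From mathcomp Require Import all_classical all_reals all_analysis.
Set Implicit Arguments. Unset Strict Implicit. Unset Printing Implicit Defensive.
Import Order.TTheory GRing.Theory Num.Theory.
Import numFieldNormedType.Exports.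
Local Open Scope classical_set_scope.
Local Open Scope ring_scope.

Section Defs.
Variable R : realType.

(* Airy function.  The contour integral
     Ai(x) = 1/(2 pi i) \int_{oo e^{-i pi/3}}^{oo e^{i pi/3}} exp(z^3/3 - z x) dz
   taken along the two rays z = t e^{-+ i pi/3}, t >= 0 (through the origin),
   where z^3 = -t^3.  The two ray integrals are complex conjugate, so
     Ai(x) = (1/pi) Im ( e^{i pi/3} \int_0^oo exp(-t^3/3 - x t e^{i pi/3}) dt )
           = (1/pi) \int_0^oo exp(-t^3/3 - x t/2) sin(pi/3 - (sqrt 3/2) x t) dt,
   an absolutely convergent Lebesgue integral. *)
Definition Airy (x : R) : R :=
  pi^-1 * Rintegral lebesgue_measure `[0%R, +oo[%classic
    (fun t : R => expR (- (t ^+ 3) / 3 - x * t / 2)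
                  * sin (pi / 3 - Num.sqrt 3 / 2 * x * t)).

Definition quartic_pot (a lambda x : R) : R := a * x ^+ 2 + lambda / 2 * x ^+ 4.

Definition asym_profile (a lambda x : R) : R :=
  x^-1 * expR (- (Num.sqrt (lambda / 2)) / 3 * x ^+ 3
               - a / (2 * Num.sqrt (lambda / 2)) * x).

Definition normalized_eigenfunction (a lambda E : R) (psi : R -> R) : Prop :=
  (forall x, derivable psi x 1) /\
  (forall x, derivable (derive1 psi) x 1) /\
  (forall x, - derive1n 2 psi x + quartic_pot a lambda x * psi x = E * psi x) /\
  (psi x @[x --> +oo] --> (0 : R)) /\
  (psi x @[x --> -oo] --> (0 : R)) /\
  ((psi x / asym_profile a lambda x) @[x --> +oo] --> (1 : R)) /\
  ((derive1 psi x / derive1 (asym_profile a lambda) x) @[x --> +oo] --> (1 : R)).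

Definition Kern (a lambda x y z : R) : R :=
  lambda `^ (3^-1) * expR (Num.sqrt (lambda / 2) * x * y * z)
  * Airy (lambda `^ (3^-1) / 2 * (x ^+ 2 + y ^+ 2 + z ^+ 2) + a / lambda `^ (2 / 3)).

End Defs.

(* Main.v *)
(** Let [F x] be the integral of [psi z * K(x,y,z)] over [z]. Since Airy's equation
    makes [K_xx - V(x) K] symmetric in [x], [y], [z], differentiating under the
    integral and integrating by parts in [z] shows that [F] solves the same
    second-order equation as [psi]. It therefore suffices to find the limit of
    [F / psi] at [+oo]: the Wronskian of [F] and [psi] then vanishes and
    [F = psi(y) psi] everywhere.

    For this limit the contour of the Airy integral is moved to the ray
    [s + t e^{i pi/3}], [t >= 0]: the imaginary part of the integral does not depend
    on the real number [s], because moving the endpoint along the real axis changes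
    the integral by a real amount. With [s] proportional to [x], the kernel [K(x,y,z)]
    equals the asymptotic profile of [psi] at [x] times a Gaussian of width
    [x^(-1/2)] centred at [z = y] times an integral over the ray that tends to a
    rotated Gaussian integral; dominated convergence along [x = n^2] gives the
    limit [psi(y)]. *)

(* No complex integral appears. Each contour integral is represented by its real or imaginary part
   along a ray, and moving the contour means varying a real parameter. By the Cauchy-Riemann
   equations the derivative of the integrand in that parameter is an exact derivative along the ray,
   so only a boundary term at the endpoint remains, and it vanishes in the part that is kept. The
   shift of the Airy ray and the rotation of the Gaussian both work this way. The limit along
   [x = n^2] is enough because the Wronskian is constant: were it nonzero, [F / psi] would be
   unbounded along every sequence tending to [+oo]. Squares make the width [x^(-1/2)] of the
   Gaussian equal to [1/n]. The quotient argument needs [psi] to be nonzero, which is known only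
   near [+oo]; the identity obtained there is carried to the whole line by backward uniqueness for
   the differential equation. *)
Require Import Defs.
From HB Require Import structures.
From mathcomp Require Import all_boot all_order all_algebra.
From mathcomp Require Import all_classical all_reals all_analysis.
From mathcomp Require Import measurable_realfun ring lra.
Set Implicit Arguments. Unset Strict Implicit. Unset Printing Implicit Defensive.
Import Order.TTheory GRing.Theory Num.Theory.
Import numFieldNormedType.Exports.
Local Open Scope classical_set_scope.
Local Open Scope ring_scope.

(** * Derivatives and dominated integrals *)

Section PointwiseDerivatives.
Variable R : realType.
Implicit Types (f g : R -> R) (x a df dg : R).

Lemma is_derive_addf f g x df dg : is_derive x 1 f df -> is_derive x 1 g dg ->
  is_derive x 1 (fun t => f t + g t) (df + dg).
Proof. exact: is_deriveD. Qed.

Lemma is_derive_oppf f x df : is_derive x 1 f df ->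
  is_derive x 1 (fun t => - f t) (- df).
Proof. exact: is_deriveN. Qed.

Lemma is_derive_mulf f g x df dg : is_derive x 1 f df -> is_derive x 1 g dg ->
  is_derive x 1 (fun t => f t * g t) (df * g x + f x * dg).
Proof.
move=> hf hg; have := is_deriveM hf hg => h.
by apply: is_derive_eq; rewrite addrC [LHS]/=; congr (_ + _); rewrite mulrC.
Qed.

Lemma is_derive_cstf a x : is_derive x 1 (fun=> a) 0.
Proof. exact: is_derive_cst. Qed.

Lemma is_derive_idf x : is_derive x 1 (fun t => t) 1.
Proof. exact: is_derive_id. Qed.

Lemma is_derive_expf f n x df : is_derive x 1 f df ->
  is_derive x 1 (fun t => f t ^+ n.+1) (n.+1%:R * f x ^+ n * df).
Proof.
move=> hf; have h := is_deriveX n.+1 hf.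
by rewrite -exprfctE; apply: is_derive_eq.
Qed.

Lemma is_derive_compf f g x df dg : is_derive (g x) 1 f df ->
  is_derive x 1 g dg -> is_derive x 1 (fun t => f (g t)) (df * dg).
Proof. by move=> hf hg; exact: is_derive1_comp. Qed.

Lemma is_derive_continuous f :
  (forall x, exists df, is_derive x 1 f df) -> continuous f.
Proof.
move=> h x; have [d [hd _]] := h x.
exact/differentiable_continuous/derivable1_diffP.
Qed.

Lemma is_derive1E f x df : is_derive x 1 f df -> derive1 f x = df.
Proof. by move=> [_ <-]; rewrite derive1E. Qed.

Lemma derivable_is_derive1 f x : derivable f x 1 -> is_derive x 1 f (derive1 f x).
Proof. by move=> h; apply: DeriveDef => //; rewrite derive1E. Qed.

(** Lets the derivative be synthesised as an existential variable first and compared with the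
    announced formula afterwards. *)
Lemma is_derive_by f x df :
  (exists d, is_derive x 1 f d /\ d = df) -> is_derive x 1 f df.
Proof. by move=> [d [h <-]]. Qed.

Lemma is_derive_MVT f (df : R -> R) (a b : R) :
  (forall x : R, is_derive x 1 f (df x)) -> a < b ->
  exists2 c, a < c < b & f b - f a = df c * (b - a).
Proof.
move=> hf ab; have [|c hc E] := @MVT R f df a b ab (fun x _ => hf x).
  by apply: continuous_subspaceT; apply: is_derive_continuous => x; exists (df x).
by exists c => //; move: hc; rewrite in_itv.
Qed.

End PointwiseDerivatives.

(* [notypeclasses] keeps instance search from closing the premises with the
   uninformative derivative ['D_1 f x]. *)
Ltac deriv_step :=
  lazymatch goal with
  | |- is_derive ?x _ (fun _ => ?c) _ => notypeclasses refine (@is_derive_cstf _ c x)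
  | |- is_derive ?x _ (fun t => GRing.add (@?f t) (@?g t)) _ =>
      notypeclasses refine (@is_derive_addf _ f g x _ _ _ _)
  | |- is_derive ?x _ (fun t => GRing.opp (@?f t)) _ =>
      notypeclasses refine (@is_derive_oppf _ f x _ _)
  | |- is_derive ?x _ (fun t => GRing.mul (@?f t) (@?g t)) _ =>
      notypeclasses refine (@is_derive_mulf _ f g x _ _ _ _)
  | |- is_derive ?x _ (fun t => GRing.exp (@?f t) _) _ =>
      notypeclasses refine (@is_derive_expf _ f _ x _ _)
  | |- is_derive ?x _ (fun t => expR (@?f t)) _ =>
      notypeclasses refine (@is_derive_compf _ expR f x _ _ (is_derive_expR _) _)
  | |- is_derive ?x _ (fun t => sin (@?f t)) _ =>
      notypeclasses refine (@is_derive_compf _ sin f x _ _ (is_derive_sin _) _)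
  | |- is_derive ?x _ (fun t => cos (@?f t)) _ =>
      notypeclasses refine (@is_derive_compf _ cos f x _ _ (is_derive_cos _) _)
  | |- is_derive _ _ (fun t => t) _ => exact: is_derive_idf
  end.
Ltac deriv := apply: is_derive_by; eexists; split; [solve [repeat deriv_step]|rewrite /=].
Ltac deriv_continuous :=
  apply: is_derive_continuous => ?; eexists; solve [repeat deriv_step].

(** * Integrals dominated by a multiple of [exp (- |t|)] *)

Section DominatedIntegrals.
Variable R : realType.
Notation mu := (@lebesgue_measure R).
Implicit Types (f g : R -> R) (D : set R) (C : R).

(** All integrands below decay like a Gaussian or like [exp (- t^3 / 3)], so one fixed dominator
    serves for integrability, differentiation under the integral and limits. *)
Definition exp_dominated D C f :=
  forall t, D t -> `|f t| <= C * expR (- `|t|).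

Lemma continuous_expRN_norm : continuous (fun t : R => expR (- `|t|)).
Proof.
move=> x; apply: (@continuous_comp _ _ _ (fun t : R => - `|t|) expR).
  by apply: continuousN; exact: norm_continuous.
exact: continuous_expR.
Qed.

Lemma continuous_EFin_measurable f D : @measurable _ (measurableTypeR R) D ->
  continuous f -> measurable_fun D (EFin \o f).
Proof.
move=> mD cf; apply/measurable_EFinP; apply: measurable_funTS => /=.
exact: continuous_measurable_fun.
Qed.

Lemma integrable_expRN_norm : mu.-integrable setT (EFin \o (fun t : R => expR (- `|t|))).
Proof.
have ce := continuous_expRN_norm.
have h0 : (\int[mu]_(x in `[0%R, +oo[) (expR (- `|x|))%:E = 0%:E - (- expR (- 0))%:E)%E.
  rewrite -(@ge0_continuous_FTC2y R (fun x => expR (- x)) (fun x => - expR (- x)) 0 0).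
  - apply: eq_integral => x; rewrite inE /= in_itv /= andbT => x0.
    by rewrite ger0_norm.
  - by move=> x _; exact: expR_ge0.
  - apply: continuous_subspaceT; deriv_continuous.
  - rewrite -[X in _ --> X]oppr0; apply: cvgN; exact: cvgr_expR.
  - move=> x _; suff h : is_derive x 1 (fun x => - expR (- x)) (expR (- x)) by case: h.
    by deriv; ring.
  - apply: cvg_at_right_filter; have : continuous (fun x : R => - expR (- x)) by deriv_continuous.
    exact.
  - move=> x _; apply: is_derive1E; by deriv; ring.
apply/integrableP; split; first exact: continuous_EFin_measurable.
under eq_integral do rewrite /= ger0_norm ?expR_ge0 //.
rewrite ge0_symfun_integralT.
- rewrite (_ : [set x : R | 0 <= x] = `[0%R, +oo[%classic); last first.
    by apply/seteqP; split=> x /=; rewrite in_itv /= andbT.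
  by rewrite h0 -EFinB -EFinM ltry.
- by move=> x; exact: expR_ge0.
- exact: ce.
- by move=> x /=; rewrite normrN.
Qed.

Lemma integrable_exp_dominator D C : @measurable _ (measurableTypeR R) D ->
  mu.-integrable D (EFin \o (fun t : R => C * expR (- `|t|))).
Proof.
move=> mD; apply: (@integrableS _ _ _ mu setT) => //.
have := integrableZl measurableT C integrable_expRN_norm.
by apply: eq_integrable => // x _ /=; rewrite EFinM.
Qed.

Lemma exp_dominated_integrable D C f : @measurable _ (measurableTypeR R) D -> continuous f ->
  exp_dominated D C f -> mu.-integrable D (EFin \o f).
Proof.
move=> mD cf hf; apply: le_integrable (integrable_exp_dominator C mD) => //.
  exact: continuous_EFin_measurable.
move=> t Dt /=; rewrite lee_fin (le_trans (hf t Dt)) //; exact: ler_norm.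
Qed.

Lemma exp_dominated_Rintegral D C f : @measurable _ (measurableTypeR R) D -> continuous f ->
  0 <= C -> exp_dominated D C f ->
  `|Rintegral mu D f| <= C * Rintegral mu setT (fun t : R => expR (- `|t|)).
Proof.
move=> mD cf C0 hf; have If := exp_dominated_integrable mD cf hf.
rewrite (le_trans (le_normr_Rintegral mD If)) //.
rewrite -RintegralZl //; last exact: integrable_expRN_norm.
apply: (@le_trans _ _ (Rintegral mu D (fun t => C * expR (- `|t|)))).
  apply: le_Rintegral => //; last exact: integrable_exp_dominator.
  by have := integrable_abse If; apply: eq_integrable.
rewrite [leLHS]Rintegral_mkcond; apply: le_Rintegral => //.
- by rewrite -restrict_EFin; apply/integrable_restrict => //; rewrite setTI; exact: integrable_exp_dominator.
- exact: integrable_exp_dominator.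
- by move=> x _; rewrite patchE; case: ifP => // _; rewrite mulr_ge0 ?expR_ge0.
Qed.

(** The bound on [df] must be uniform near [x0]. The one on [f] only provides integrability, so its
    constant may vary with [x]. *)
Lemma is_derive_exp_dominated D C (f df : R -> R -> R) (x0 e : R) : 0 < e ->
  @measurable _ (measurableTypeR R) D -> (forall x, continuous (f x)) ->
  (forall x, `|x - x0| < e -> exists C', exp_dominated D C' (f x)) ->
  (forall x t, D t -> is_derive (x : R) 1 (f ^~ t) (df x t)) ->
  (forall x, `|x - x0| < e -> exp_dominated D C (df x)) ->
  is_derive x0 1 (fun x => Rintegral mu D (f x)) (Rintegral mu D (df x0)).
Proof.
move=> e0 mD cf If hd hC.
have C_ge0 (t : R) : 0 <= `|C| * expR (- `|t|) by rewrite mulr_ge0 ?expR_ge0.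
have hI (x : R) : `](x0 - e), (x0 + e)[%classic x -> `|x - x0| < e.
  by rewrite /= in_itv /= => /andP[h1 h2]; rewrite ltr_norml; apply/andP; split; lra.
have Ix0 : `](x0 - e), (x0 + e)[%classic x0 by rewrite /= in_itv /=; apply/andP; split; lra.
have Intf x : `](x0 - e), (x0 + e)[%classic x -> mu.-integrable D (EFin \o f x).
  by move=> /hI hx; have [C' h] := If x hx; exact: exp_dominated_integrable h.
have derf (x t : R) : `](x0 - e), (x0 + e)[%classic x -> D t -> derivable (f ^~ t) x 1.
  by move=> _ Dt; have [] := hd x t Dt.
have G_ub (x t : R) : `](x0 - e), (x0 + e)[%classic x -> D t ->
    `|partial1of2 f x t| <= `|C| * expR (- `|t|).
  move=> Hx Dt; rewrite /partial1of2 (is_derive1E (hd x t Dt)).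
  rewrite (le_trans (hC x (hI x Hx) t Dt)) // ler_wpM2r ?expR_ge0 //; exact: ler_norm.
have mG := integrable_exp_dominator `|C| mD.
have dv := derivable_under_integral mD Ix0 Intf derf C_ge0 mG G_ub.
have := differentiation_under_integral mD Ix0 Intf derf C_ge0 mG G_ub.
move=> E; apply: is_derive_by; eexists; split; first exact: derivable_is_derive1 dv.
rewrite E; apply: eq_Rintegral => t; rewrite inE => Dt.
by rewrite /partial1of2 (is_derive1E (hd x0 t Dt)).
Qed.

Lemma cvg_Rintegral_exp_dominated D C (f_ : nat -> R -> R) f : @measurable _ (measurableTypeR R) D ->
  (forall n, measurable_fun D (EFin \o f_ n)) ->
  (forall n, exp_dominated D C (f_ n)) ->
  (forall t, D t -> f_ n t @[n --> \oo] --> f t) ->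
  Rintegral mu D (f_ n) @[n --> \oo] --> Rintegral mu D f.
Proof.
move=> mD mf hf lf.
have Ig := integrable_exp_dominator C mD.
have lf' t : D t -> (EFin \o f_ n) t @[n --> \oo] --> (EFin \o f) t.
  by move=> Dt; apply: cvg_EFin; [exact: nearW|exact: lf].
have mfl : measurable_fun D (EFin \o f) by apply: emeasurable_fun_cvg lf'.
have [||If _ h] := @dominated_convergence _ _ _ mu _ mD (fun n => EFin \o f_ n) _ _ mf mfl
  _ Ig _.
- by apply: aeW.
- by apply: aeW => t n Dt /=; rewrite lee_fin; exact: hf.
apply: fine_cvg; rewrite fineK //; exact: integrable_fin_num.
Qed.

Lemma cvg_Rintegral_exhaustion D C g (P_ : nat -> set R) :
  @measurable _ (measurableTypeR R) D ->
  (forall n, @measurable _ (measurableTypeR R) (P_ n)) ->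
  continuous g -> exp_dominated D C g ->
  (forall t, D t -> \forall n \near \oo, P_ n t) ->
  Rintegral mu (D `&` P_ n) g @[n --> \oo] --> Rintegral mu D g.
Proof.
move=> mD mP cg hg hP.
under eq_fun do rewrite Rintegral_mkcondr.
apply: (@cvg_Rintegral_exp_dominated D C) => //.
- move=> n; apply/measurable_EFinP; apply/(measurable_restrict _ _ _).1 => //.
    exact: mP.
  by apply: measurable_funTS; exact: continuous_measurable_fun.
- move=> n t Dt; rewrite patchE; case: ifP => _; first exact: hg.
  by rewrite normr0 (le_trans _ (hg t Dt)).
- move=> t Dt; apply: cvg_near_cst.
  by near=> n; rewrite patchE mem_set //; near: n; exact: hP.
Unshelve. all: by end_near. Qed.

Lemma exp_dominated_cvg0 D C G (u : nat -> R) : (forall n, D (u n)) ->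
  (forall n, `|u n| = n.+1%:R) -> exp_dominated D C G ->
  G (u n) @[n --> \oo] --> (0 : R).
Proof.
move=> Du hu hG; apply: norm_cvg0.
apply: (squeeze_cvgr (f := fun=> 0) (h := fun n : nat => C * expR (- n.+1%:R))).
- by near=> n; rewrite normr_ge0 /= (le_trans (hG _ (Du n))) // hu.
- exact: cvg_cst.
- rewrite -(mulr0 C); apply: cvgM; first exact: cvg_cst.
  apply: (@cvg_comp _ _ _ (fun n : nat => n.+1%:R : R) (fun x => expR (- x)) \oo +oo%R).
    apply/cvgryPge => A; near=> n; near: n.
    have := @cvgr_idn R => /cvgryPge/(_ A); apply: filterS => n /= h.
    by rewrite (le_trans h) // ler_nat.
  exact: cvgr_expR.
Unshelve. all: by end_near. Qed.

Lemma Rintegral_FTC2 (G g : R -> R) (a b : R) : a < b -> continuous g ->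
  (forall x : R, is_derive x 1 G (g x)) ->
  Rintegral mu `[a, b]%classic g = G b - G a.
Proof.
move=> ab cg dG; have cG : continuous G by apply: is_derive_continuous => x; exists (g x).
rewrite /Rintegral (@continuous_FTC2 R g G a b) //.
- exact: continuous_subspaceT.
- split; first by move=> x _; case: (dG x).
    by apply: cvg_at_right_filter; exact: cG.
  by apply: cvg_at_left_filter; exact: cG.
- by move=> x _; exact: is_derive1E.
Qed.

(** The decay of the primitive removes the boundary term at infinity. Both contour movements and
    Airy's equation come down to this evaluation. *)
Lemma Rintegral_derive_0y (G g : R -> R) (C C' : R) : continuous g ->
  (forall x : R, is_derive x 1 G (g x)) ->
  exp_dominated `[0%R, +oo[%classic C g -> exp_dominated `[0%R, +oo[%classic C' G ->
  Rintegral mu `[0%R, +oo[%classic g = - G 0.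
Proof.
move=> cg dG hg hG.
have m0 : @measurable _ (measurableTypeR R) `[0%R, +oo[%classic by exact: measurable_itv.
have mn n : @measurable _ (measurableTypeR R) `[0%R, n.+1%:R]%classic by exact: measurable_itv.
have h1 := @cvg_Rintegral_exhaustion _ _ _ (fun n => `[0%R, n.+1%:R]%classic) m0 mn cg hg.
have {}h1 : Rintegral mu `[0%R, n.+1%:R]%classic g @[n --> \oo]
   --> Rintegral mu `[0%R, +oo[%classic g.
  have -> : (fun n => Rintegral mu `[0%R, n.+1%:R]%classic g) =
     (fun n => Rintegral mu (`[0%R, +oo[%classic `&` `[0%R, n.+1%:R]%classic) g).
    apply/funext => n; congr Rintegral; rewrite setIC; apply/esym/setIidPl.
    by move=> x /=; rewrite !in_itv /= => /andP[-> _].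
  apply: h1 => t /=; rewrite in_itv /= andbT => t0.
  have := @cvgr_idn R => /cvgryPge/(_ t); apply: filterS => n /= h.
  by rewrite in_itv /= t0 (le_trans h) // ler_nat.
have h2 : Rintegral mu `[0%R, n.+1%:R]%classic g @[n --> \oo] --> 0 - G 0.
  under eq_fun do rewrite (@Rintegral_FTC2 G g) ?ltr0n //.
  apply: cvgB; last exact: cvg_cst.
  by apply: exp_dominated_cvg0 hG => n; rewrite ?ger0_norm ?ler0n //= in_itv /= ler0n.
by rewrite (cvg_unique _ h1 h2) // sub0r.
Qed.

Lemma Rintegral_derive_T (G g : R -> R) (C C' : R) : continuous g ->
  (forall x : R, is_derive x 1 G (g x)) ->
  exp_dominated setT C g -> exp_dominated setT C' G ->
  Rintegral mu setT g = 0.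
Proof.
move=> cg dG hg hG.
have mn n : @measurable _ (measurableTypeR R) `[- n.+1%:R, n.+1%:R : R]%classic by exact: measurable_itv.
have h1 := @cvg_Rintegral_exhaustion _ _ _ (fun n => `[- n.+1%:R, n.+1%:R]%classic) measurableT mn cg hg.
have {}h1 : Rintegral mu `[- n.+1%:R, n.+1%:R]%classic g @[n --> \oo]
   --> Rintegral mu setT g.
  have -> : (fun n => Rintegral mu `[- n.+1%:R, n.+1%:R]%classic g) =
     (fun n => Rintegral mu (setT `&` `[- n.+1%:R, n.+1%:R]%classic) g).
    by apply/funext => n; rewrite setTI.
  apply: h1 => t _.
  have := @cvgr_idn R => /cvgryPge/(_ `|t|); apply: filterS => n /= h.
  by rewrite in_itv /= -ler_norml (le_trans h) // ler_nat.
have h2 : Rintegral mu `[- n.+1%:R, n.+1%:R]%classic g @[n --> \oo] --> (0 : R) - 0.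
  under eq_fun do rewrite (@Rintegral_FTC2 G g) ?gtrN ?ltr0n //.
  by apply: cvgB; apply: exp_dominated_cvg0 hG => n //; rewrite ?normrN ger0_norm.
by rewrite (cvg_unique _ h1 h2) // subr0.
Qed.

(** The change of variables with constant Jacobian [r] is assumed for nonnegative functions only. It
    applies to the dominator and to [f] plus the dominator, and [f] is their difference. *)
Lemma Rintegral_substitution D (F : R -> R) (r C : R) f :
  @measurable _ (measurableTypeR R) D -> 0 < r ->
  (forall h : R -> R, continuous h -> (forall x, D x -> 0 <= h x) ->
     (\int[mu]_(x in D) (h x)%:E = \int[mu]_(x in D) (h (F x) * r)%:E)%E) ->
  continuous F -> (forall x, D x -> D (F x)) ->
  continuous f -> exp_dominated D C f ->
  Rintegral mu D f = r * Rintegral mu D (fun t => f (F t)).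
Proof.
move=> mD r0 HA cF DF cf hf.
have main (h : R -> R) : continuous h -> (forall x, D x -> 0 <= h x) ->
    mu.-integrable D (EFin \o h) ->
    mu.-integrable D (EFin \o (fun t => h (F t))) /\
    Rintegral mu D h = r * Rintegral mu D (fun t => h (F t)).
  move=> ch h0 Ih.
  have cr : continuous (fun t => h (F t) * r).
    move=> t; apply: continuousM; last exact: cvg_cst.
    by apply: (@continuous_comp _ _ _ F h); [exact: cF|exact: ch].
  have I1 : mu.-integrable D (EFin \o (fun t => h (F t) * r)).
    apply/integrableP; split; first exact: continuous_EFin_measurable.
    have /integrableP[_] := Ih.
    rewrite (_ : \int[mu]_(x in D) `|(EFin \o h) x| = \int[mu]_(x in D) (h x)%:E)%E; last first.
      by apply: eq_integral => x; rewrite inE => Dx /=; rewrite ger0_norm ?h0.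
    rewrite (HA _ ch h0); congr (_ < _)%E; apply: eq_integral => x; rewrite inE => Dx /=.
    by rewrite ger0_norm // mulr_ge0 ?h0 ?ltW //; exact: DF.
  have I2 : mu.-integrable D (EFin \o (fun t => h (F t))).
    have := integrableZl mD r^-1 I1; apply: eq_integrable => // x _ /=.
    by rewrite -EFinM mulrC mulfK // gt_eqF.
  split=> //; rewrite -RintegralZl //.
  by rewrite /Rintegral (HA _ ch h0); congr fine; apply: eq_integral => x _; rewrite mulrC.
pose g (t : R) := `|C| * expR (- `|t|).
have cg : continuous g.
  by move=> t; apply: cvgM; [exact: cvg_cst|exact: continuous_expRN_norm].
have g0 x : D x -> 0 <= g x by move=> _; rewrite /g mulr_ge0 ?expR_ge0.
have Ig : mu.-integrable D (EFin \o g) by exact: integrable_exp_dominator.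
have If : mu.-integrable D (EFin \o f) by exact: exp_dominated_integrable hf.
have cfg : continuous (fun x => f x + g x).
  by move=> t; apply: continuousD; [exact: cf|exact: cg].
have fg0 x : D x -> 0 <= f x + g x.
  move=> Dx; have := hf x Dx; rewrite ler_norml => /andP[h _].
  have : C * expR (- `|x|) <= g x by rewrite ler_wpM2r ?expR_ge0 // ler_norm.
  by move=> h2; rewrite addrC -[f x]opprK subr_ge0 (le_trans _ h2) // lerNl.
have Ifg : mu.-integrable D (EFin \o (fun x => f x + g x)).
  by have := integrableD mD If Ig; apply: eq_integrable.
have [Ig' Eg] := main _ cg g0 Ig.
have [Ifg' Efg] := main _ cfg fg0 Ifg.
have -> : Rintegral mu D f = Rintegral mu D (fun x => f x + g x) - Rintegral mu D g.
  by rewrite -RintegralB //; apply: eq_Rintegral => x _; rewrite addrK.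
rewrite Efg Eg -mulrBr -RintegralB //; congr (_ * _).
by apply: eq_Rintegral => x _; rewrite addrK.
Qed.

Lemma is_derive_affine (r y x : R) : is_derive x 1 (fun t : R => y + t * r) r.
Proof. by deriv; ring. Qed.

Lemma derive1_affine (r y : R) : derive1 (fun t : R => y + t * r) = cst r.
Proof. by apply/funext => x; exact/is_derive1E/is_derive_affine. Qed.

Lemma continuous_affine (r y : R) : continuous (fun t : R => y + t * r).
Proof. by deriv_continuous. Qed.

Lemma cvgy_affine (r y : R) : 0 < r -> y + t * r @[t --> +oo%R] --> +oo%R.
Proof.
move=> r0; apply/cvgryPge => A; near=> t.
rewrite -lerBlDl -ler_pdivrMr //; near: t; exact: nbhs_pinfty_ge.
Unshelve. all: by end_near. Qed.

Lemma cvgNy_affine (r y : R) : 0 < r -> y + t * r @[t --> -oo%R] --> -oo%R.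
Proof.
move=> r0; apply/cvgrNyPle => A; near=> t.
rewrite -lerBrDl -ler_pdivlMr //; near: t; exact: nbhs_ninfty_le.
Unshelve. all: by end_near. Qed.

Lemma Rintegral_scale_0y f (r C : R) : 0 < r -> continuous f ->
  exp_dominated `[0%R, +oo[%classic C f ->
  Rintegral mu `[0%R, +oo[%classic f =
  r * Rintegral mu `[0%R, +oo[%classic (fun t => f (t * r)).
Proof.
move=> r0 cf hf.
have -> : (fun t => f (t * r)) = (fun t => f (0 + t * r)).
  by apply/funext => t; rewrite add0r.
apply: (@Rintegral_substitution _ (fun t => 0 + t * r) _ C) => //.
- move=> h ch h0.
  have := @increasing_ge0_integration_by_substitutiony R (fun t => 0 + t * r) h 0.
  rewrite mul0r addr0 derive1_affine => -> //.
  + by move=> x z _ _ xz; rewrite /= !add0r ltr_pM2r.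
  + by move=> x _; exact: cvg_cst.
  + exact: is_cvg_cst.
  + exact: is_cvg_cst.
  + split; first by move=> x _; case: (is_derive_affine r 0 x).
    by apply: cvg_at_right_filter; exact: continuous_affine.
  + exact: cvgy_affine.
  + exact: continuous_subspaceT.
  + move=> x; rewrite in_itv /= andbT => x0; apply: h0.
    by rewrite /= in_itv /= andbT ltW.
- exact: continuous_affine.
- by move=> x /=; rewrite !in_itv /= !andbT add0r => x0; rewrite mulr_ge0 // ltW.
Qed.

Lemma Rintegral_affine_T f (r y C : R) : 0 < r -> continuous f ->
  exp_dominated setT C f ->
  Rintegral mu setT f = r * Rintegral mu setT (fun t => f (y + t * r)).
Proof.
move=> r0 cf hf.
apply: (@Rintegral_substitution _ (fun t => y + t * r) _ C) => //.
- move=> h ch h0.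
  rewrite (@increasing_ge0_integration_by_substitutionT _ (fun t => y + t * r)).
  + by apply: eq_integral => x _; rewrite derive1_affine.
  + by move=> x z xz; rewrite /= ltrD2l ltr_pM2r.
  + by rewrite derive1_affine => x; exact: cvg_cst.
  + by rewrite derive1_affine; exact: is_cvg_cst.
  + by rewrite derive1_affine; exact: is_cvg_cst.
  + by move=> x; case: (is_derive_affine r y x).
  + exact: cvgNy_affine.
  + exact: cvgy_affine.
  + exact: ch.
  + by move=> x; exact: h0.
- exact: continuous_affine.
Qed.

End DominatedIntegrals.

(** * Gaussian and cubic exponents against [exp (- |t|)] *)

Section ExponentialBounds.
Variable R : realType.
Implicit Types M t a : R.

(** Completing the square: [(M + 1)^2 / (4 a)] is the maximum of [(M + 1) s - a s^2]. *)
Lemma expR_gauss_dominated M a : 0 < a -> exists2 C : R, 0 <= C &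
  forall t, expR (M * `|t| - a * t ^+ 2) <= C * expR (- `|t|).
Proof.
move=> a0; exists (expR ((M + 1) ^+ 2 / (4 * a))); first exact: expR_ge0.
move=> t; rewrite -expRD ler_expR -(real_normK (num_real t)).
set s := `|t|; rewrite -subr_ge0.
have -> : (M + 1) ^+ 2 / (4 * a) - s - (M * s - a * s ^+ 2) =
   ((M + 1) - 2 * a * s) ^+ 2 / (4 * a) by field; rewrite gt_eqF.
by rewrite divr_ge0 ?sqr_ge0 // mulr_ge0 // ltW.
Qed.

(** For [t >= 0] the maximum of [L t^2 - t^3 / 3] is [4 L^3 / 3], reached at the double root
    [t = 2 L]. Taking [L = |N| + 1] rather than [|N|] leaves a spare [- t^2], which reduces the
    claim to the Gaussian bound. *)
Lemma expR_cubic_dominated M N : exists2 C : R, 0 <= C &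
  forall t, 0 <= t -> expR (M * t + N * t ^+ 2 - t ^+ 3 / 3) <= C * expR (- `|t|).
Proof.
have [C C0 hC] := @expR_gauss_dominated M 1 ltr01.
pose L := `|N| + 1.
have L0 : 0 <= L by rewrite addr_ge0.
exists (expR (4 / 3 * L ^+ 3) * C); first by rewrite mulr_ge0 ?expR_ge0.
move=> t t0; rewrite -mulrA.
apply: (@le_trans _ _ (expR (4 / 3 * L ^+ 3) * expR (M * `|t| - 1 * t ^+ 2))); last first.
  by rewrite ler_wpM2l ?expR_ge0.
rewrite -expRD ler_expR ger0_norm // -subr_ge0.
have -> : 4 / 3 * L ^+ 3 + (M * t - 1 * t ^+ 2) - (M * t + N * t ^+ 2 - t ^+ 3 / 3) =
  (t - 2 * L) ^+ 2 * (t + L) / 3 + (`|N| - N) * t ^+ 2 by rewrite /L; field.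
rewrite addr_ge0 //; first by rewrite divr_ge0 // mulr_ge0 ?sqr_ge0 // addr_ge0.
by rewrite mulr_ge0 ?sqr_ge0 // subr_ge0 ler_norm.
Qed.

Lemma norm_le_expR t : `|t| <= expR `|t|.
Proof. by rewrite (le_trans _ (expR_ge1Dx _)) // lerDr. Qed.

End ExponentialBounds.

(** * The Airy function *)

Section PiThird.
Variable R : realType.

(** Since [2 pi / 3 = pi - pi / 3], the doubling formula makes the cosine a root of
    [(2 c - 1) (c + 1)], and it is positive. *)
Lemma cos_pi_third : cos (pi / 3 : R) = 1 / 2.
Proof.
have p0 := pi_gt0 R.
have c0 : 0 < cos (pi / 3 : R) by apply: cos_gt0_pihalf; apply/andP; split; lra.
have E : cos ((pi / 3 : R) *+ 2) = - cos (pi / 3).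
  have -> : (pi / 3 : R) *+ 2 = - (pi / 3) + pi by rewrite mulr2n; field.
  by rewrite cosDpi cosN.
rewrite cos_mulr2n mulr2n in E; set c := cos _ in E c0 *.
have : (c - 1 / 2) * (c + 1) = 0 by lra.
by move/eqP; rewrite mulf_eq0 => /orP[/eqP|/eqP]; lra.
Qed.

Lemma sqr_sqrt3_half : (Num.sqrt 3 / 2 : R) ^+ 2 = 3 / 4.
Proof. by rewrite exprMn sqr_sqrtr //; field. Qed.

Lemma sin_pi_third : sin (pi / 3 : R) = Num.sqrt 3 / 2.
Proof.
have p0 := pi_gt0 R.
have s0 : 0 < sin (pi / 3 : R) by apply: sin_gt0_pi; apply/andP; split; lra.
have : sin (pi / 3 : R) ^+ 2 = (Num.sqrt 3 / 2) ^+ 2.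
  by rewrite sin2cos2 cos_pi_third sqr_sqrt3_half; field.
move/eqP; rewrite eqrXn2 //; first by move/eqP.
exact: ltW.
Qed.

Lemma sinD_pi_third (b : R) :
  sin (pi / 3 + b) = Num.sqrt 3 / 2 * cos b + sin b / 2.
Proof. by rewrite sinD sin_pi_third cos_pi_third; ring. Qed.

Lemma cosD_pi_third (b : R) :
  cos (pi / 3 + b) = cos b / 2 - Num.sqrt 3 / 2 * sin b.
Proof. by rewrite cosD sin_pi_third cos_pi_third; ring. Qed.

End PiThird.

Section AiryFunction.
Variable R : realType.
Notation mu := (@lebesgue_measure R).
Notation Ry := (`[0%R, +oo[%classic : set R).
Notation k := (Num.sqrt 3 / 2 : R).
Implicit Types (s u t phi : R).

Let mRy : @measurable _ (measurableTypeR R) Ry.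
Proof. exact: measurable_itv. Qed.

(* Imaginary part of [exp (i phi + z^3/3 - z u)] on the ray [z = s + t e^{i pi/3}]. *)
Definition airy_ray phi s u t :=
  expR (s ^+ 3 / 3 - s * u + (s ^+ 2 - u) / 2 * t - s / 2 * t ^+ 2 - t ^+ 3 / 3)
  * sin (phi + k * ((s ^+ 2 - u) * t + s * t ^+ 2)).

Lemma airy_ray_bound phi s u t : `|airy_ray phi s u t| <=
  expR (s ^+ 3 / 3 - s * u + (s ^+ 2 - u) / 2 * t - s / 2 * t ^+ 2 - t ^+ 3 / 3).
Proof.
by rewrite normrM (ger0_norm (expR_ge0 _)) ler_piMr ?expR_ge0 ?sin_max.
Qed.

Lemma continuous_airy_ray phi s u : continuous (airy_ray phi s u).
Proof. by rewrite /airy_ray; deriv_continuous. Qed.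

Lemma airy_ray_dominated phi s u : exists C, exp_dominated Ry C (airy_ray phi s u).
Proof.
have [C C0 hC] := expR_cubic_dominated ((s ^+ 2 - u) / 2) (- (s / 2)).
exists (expR (s ^+ 3 / 3 - s * u) * C) => t; rewrite /= in_itv /= andbT => t0.
rewrite (le_trans (airy_ray_bound _ _ _ _)) //.
rewrite -[leRHS]mulrA; apply: le_trans (ler_wpM2l (expR_ge0 (s ^+ 3 / 3 - s * u)) (hC t t0)).
by rewrite -expRD ler_expR; lra.
Qed.

Definition airy_ray_dt s u t :=
  expR (s ^+ 3 / 3 - s * u + (s ^+ 2 - u) / 2 * t - s / 2 * t ^+ 2 - t ^+ 3 / 3)
  * (((s ^+ 2 - u) / 2 - s * t - t ^+ 2) * sin (k * ((s ^+ 2 - u) * t + s * t ^+ 2))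
     + k * (s ^+ 2 - u + 2 * s * t) * cos (k * ((s ^+ 2 - u) * t + s * t ^+ 2))).

Lemma is_derive_airy_ray_t s u t :
  is_derive t 1 (airy_ray 0 s u) (airy_ray_dt s u t).
Proof.
rewrite /airy_ray /airy_ray_dt; deriv; rewrite !add0r.
by field.
Qed.

(* By the Cauchy-Riemann equations, turning the phase by [pi/3] exchanges [d/ds] and [d/dt]. *)
Lemma is_derive_airy_ray_s s u t :
  is_derive s 1 (fun s => airy_ray (pi / 3) s u t) (airy_ray_dt s u t).
Proof.
rewrite /airy_ray /airy_ray_dt; deriv; rewrite sinD_pi_third cosD_pi_third.
have k2 := sqr_sqrt3_half R.
set E := expR _; set S := sin _; set C := cos _; set kk := k in k2 *.
apply/eqP; rewrite -subr_eq0; apply/eqP.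
transitivity (- (kk ^+ 2 - 3 / 4) * (2 * s * t + t ^+ 2) * E * S); first by field.
by rewrite k2; ring.
Qed.

Lemma sqrt3_half_le1 : `|k| <= 1.
Proof.
rewrite ger0_norm ?divr_ge0 ?sqrtr_ge0 //.
by rewrite -(@ler_pXn2r _ 2) ?nnegrE ?divr_ge0 ?sqrtr_ge0 // sqr_sqrt3_half expr1n; lra.
Qed.

Lemma airy_ray_dt_dominated s0 u : exists C, forall s, `|s - s0| < 1 ->
  exp_dominated Ry C (airy_ray_dt s u).
Proof.
pose S := `|s0| + 1; pose U := `|u|.
have S0 : 0 <= S by rewrite addr_ge0.
have U0 : 0 <= U by rewrite normr_ge0.
(* The additional 2 pays for [expR (2 * t)], which bounds each of [1], [t] and [t^2] in the
   polynomial prefactor; [c] bounds the sum of their coefficients. *)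
have [C C0 hC] := expR_cubic_dominated (2 + (S ^+ 2 + U) / 2) (S / 2).
pose c := 2 * (S ^+ 2 + U) + 3 * S + 1.
have c0 : 0 <= c by rewrite !addr_ge0 ?mulr_ge0 ?addr_ge0 ?sqr_ge0.
exists (c * expR (S ^+ 3 / 3 + S * U) * C) => s hs t; rewrite /= in_itv /= andbT => t0.
have sS : `|s| <= S.
  by rewrite -[s](subrK s0) addrC (le_trans (ler_normD _ _)) // lerD2l ltW.
have s2 : s ^+ 2 <= S ^+ 2 by rewrite -(real_normK (num_real s)) lerXn2r ?nnegrE.
have s3 : s ^+ 3 <= S ^+ 3.
  by rewrite (le_trans (ler_norm _)) // normrX lerXn2r ?nnegrE.
have su : - (s * u) <= S * U.
  by rewrite (le_trans (ler_norm _)) // normrN normrM ler_pM.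
have uU : `|s ^+ 2 - u| <= S ^+ 2 + U.
  by rewrite (le_trans (ler_normB _ _)) // lerD // ger0_norm ?sqr_ge0.
have ut : (s ^+ 2 - u) * t <= (S ^+ 2 + U) * t.
  by rewrite ler_wpM2r // (le_trans (ler_norm _)).
have st : - s * t ^+ 2 <= S * t ^+ 2.
  by rewrite ler_wpM2r ?sqr_ge0 // (le_trans (ler_norm _)) // normrN.
rewrite /airy_ray_dt normrM (ger0_norm (expR_ge0 _)) mulrC.
have e1 : 1 <= expR t by rewrite -expR0 ler_expR.
have e2 : t <= expR t by have := norm_le_expR t; rewrite ger0_norm.
have hA : expR (s ^+ 3 / 3 - s * u + (s ^+ 2 - u) / 2 * t - s / 2 * t ^+ 2 - t ^+ 3 / 3)
   <= expR (S ^+ 3 / 3 + S * U) * expR ((S ^+ 2 + U) / 2 * t + S / 2 * t ^+ 2 - t ^+ 3 / 3).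
  by rewrite -expRD ler_expR; lra.
apply: (@le_trans _ _ ((c * expR (2 * t)) * (expR (S ^+ 3 / 3 + S * U) *
  expR ((S ^+ 2 + U) / 2 * t + S / 2 * t ^+ 2 - t ^+ 3 / 3)))); last first.
  rewrite -!mulrA ler_wpM2l // mulrCA ler_wpM2l ?expR_ge0 // -expRD.
  by rewrite (le_trans _ (hC t t0)) // ler_expR; lra.
apply: ler_pM => //.
rewrite (le_trans (ler_normD _ _)) //.
have -> : expR (2 * t) = expR t ^+ 2 by rewrite expRM_natl.
have hE : 0 <= expR t by exact: expR_ge0.
have sk := sqrt3_half_le1.
have h1 : `|((s ^+ 2 - u) / 2 - s * t - t ^+ 2) * sin (k * ((s ^+ 2 - u) * t + s * t ^+ 2))|
  <= (S ^+ 2 + U) / 2 + S * t + t ^+ 2.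
  rewrite normrM (le_trans (ler_piMr _ (sin_max _))) //.
  rewrite (le_trans (ler_normB _ _)) // (ger0_norm (sqr_ge0 _)) lerD2r.
  rewrite (le_trans (ler_normB _ _)) // lerD // normrM.
    by rewrite (ger0_norm (_ : 0 <= 2^-1)) // ler_wpM2r.
  by rewrite (ger0_norm t0) ler_wpM2r.
have h2 : `|k * (s ^+ 2 - u + 2 * s * t) * cos (k * ((s ^+ 2 - u) * t + s * t ^+ 2))|
  <= S ^+ 2 + U + 2 * S * t.
  rewrite normrM (le_trans (ler_piMr _ (cos_max _))) // normrM.
  rewrite (le_trans (ler_piMl _ sk)) // (le_trans (ler_normD _ _)) // lerD // !normrM.
  by rewrite (ger0_norm t0) ger0_norm // ler_wpM2r // ler_wpM2l.
rewrite (le_trans (lerD h1 h2)) //.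
have f1 : 1 <= expR t ^+ 2 by rewrite expr_ge1.
have f2 : t ^+ 2 <= expR t ^+ 2 by rewrite lerXn2r ?nnegrE.
have f3 : t <= expR t ^+ 2 by rewrite (le_trans e2) // expr2 ler_peMl.
have g1 := ler_wpM2l (addr_ge0 (sqr_ge0 S) U0) f1.
have g2 := ler_wpM2l S0 f3.
rewrite mulr1 in g1; have := sqr_ge0 S; rewrite /c; lra.
Qed.

Lemma Airy_ray s u :
  Airy u = pi^-1 * Rintegral mu Ry (airy_ray (pi / 3) s u).
Proof.
have -> : Rintegral mu Ry (airy_ray (pi / 3) s u) = Rintegral mu Ry (airy_ray (pi / 3) 0 u).
  apply: (@is_derive_0_is_cst R (fun s => Rintegral mu Ry (airy_ray (pi / 3) s u))).
  move=> s0; have [C hC] := airy_ray_dt_dominated s0 u.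
  apply: is_derive_by; eexists; split.
    apply: (@is_derive_exp_dominated _ Ry C (fun s => airy_ray (pi / 3) s u)
       (fun s => airy_ray_dt s u) _ 1) => //.
    - by move=> x; exact: continuous_airy_ray.
    - by move=> x _; exact: airy_ray_dominated.
    - by move=> x t _; exact: is_derive_airy_ray_s.
  have [C' hC'] := airy_ray_dominated 0 s0 u.
  have cdt : continuous (airy_ray_dt s0 u) by rewrite /airy_ray_dt; deriv_continuous.
  have hdt : exp_dominated Ry C (airy_ray_dt s0 u) by apply: hC; rewrite subrr normr0.
  (* The derivative in [s] is the integral of a [t]-derivative. The remaining boundary value at
     [t = 0] has phase 0, so its sine vanishes. *)
  rewrite (Rintegral_derive_0y cdt (is_derive_airy_ray_t s0 u) hdt hC').
  by rewrite /airy_ray expr0n /= !(mulr0, addr0) sin0 mulr0 oppr0.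
rewrite /Airy; congr (_ * _); apply: eq_Rintegral => t _; rewrite /airy_ray.
by congr (expR _ * sin _); field.
Qed.

(* The [n]-th derivative in [u] of the integrand defining [Airy], up to sign. *)
Definition airy_moment n phi u t :=
  t ^+ n * (expR (- (t ^+ 3) / 3 - u * t / 2) * sin (phi - k * u * t)).

Lemma airy_moment_dominated n u0 : exists C, forall phi u, `|u - u0| < 1 ->
  exp_dominated Ry C (airy_moment n phi u).
Proof.
have [C C0 hC] := expR_cubic_dominated (n%:R + (`|u0| + 1) / 2) 0.
exists C => phi u hu t; rewrite /= in_itv /= andbT => t0.
rewrite (le_trans _ (hC t t0)) //.
rewrite !normrM normrX (ger0_norm t0) (ger0_norm (expR_ge0 _)).
rewrite mulrA (le_trans (ler_piMr _ (sin_max _))) ?mulr_ge0 ?expR_ge0 ?exprn_ge0 //.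
have tn : t ^+ n <= expR (n%:R * t).
  rewrite expRM_natl lerXn2r ?nnegrE ?expR_ge0 //.
  by have := norm_le_expR t; rewrite ger0_norm.
rewrite (le_trans (ler_wpM2r (expR_ge0 _) tn)) // -expRD ler_expR.
have uu : - u <= `|u0| + 1.
  have := ler_norm (- u0); rewrite normrN.
  by move: hu; rewrite ltr_norml => /andP[? ?]; lra.
have := ler_wpM2r t0 uu; lra.
Qed.

Lemma continuous_airy_moment n phi u : continuous (airy_moment n phi u).
Proof.
(* The power rule used by [deriv_continuous] covers positive exponents only. *)
case: n => [|n]; rewrite /airy_moment; last by deriv_continuous.
have -> : (fun t => t ^+ 0 * (expR (- (t ^+ 3) / 3 - u * t / 2) * sin (phi - k * u * t)))
  = (fun t => (expR (- (t ^+ 3) / 3 - u * t / 2) * sin (phi - k * u * t))).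
  by apply/funext => t; rewrite expr0 mul1r.
by deriv_continuous.
Qed.

(** Differentiating [exp (- u t e^{i pi/3})] in [u] multiplies it by [- t e^{i pi/3}]: the power
    rises by one and the phase turns by [pi/3]. *)
Lemma is_derive_airy_moment n phi u t :
  is_derive u 1 (fun u => airy_moment n phi u t) (- airy_moment n.+1 (pi / 3 + phi) u t).
Proof.
rewrite /airy_moment; deriv; rewrite -[pi / 3 + phi - _]addrA sinD_pi_third.
by rewrite [t ^+ n.+1]exprS; field.
Qed.

Lemma is_derive_int_airy_moment n phi u :
  is_derive u 1 (fun u => Rintegral mu Ry (airy_moment n phi u))
    (- Rintegral mu Ry (airy_moment n.+1 (pi / 3 + phi) u)).
Proof.
have [C hC] := airy_moment_dominated n.+1 u.
apply: is_derive_by; eexists; split.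
  apply: (@is_derive_exp_dominated _ Ry C (airy_moment n phi)
    (fun u t => - airy_moment n.+1 (pi / 3 + phi) u t) _ 1) => //.
  - by move=> x; exact: continuous_airy_moment.
  - move=> x _; have [C' h] := airy_moment_dominated n x.
    by exists C'; apply: h; rewrite subrr normr0.
  - by move=> x t _; exact: is_derive_airy_moment.
  - by move=> x hx t Dt; rewrite normrN; exact: hC.
rewrite -[RHS]mulN1r -RintegralZl //.
  by apply: eq_Rintegral => t _; rewrite mulN1r.
apply: (@exp_dominated_integrable _ _ C) => //; first exact: continuous_airy_moment.
by apply: hC; rewrite subrr normr0.
Qed.

Definition Airy' u := - (pi^-1 * Rintegral mu Ry (airy_moment 1 (pi / 3 + pi / 3) u)).

Lemma AiryE : @Airy R = fun u => pi^-1 * Rintegral mu Ry (airy_moment 0 (pi / 3) u).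
Proof.
apply/funext => u; rewrite /Airy; congr (_ * _); apply: eq_Rintegral => t _.
by rewrite /airy_moment expr0 mul1r.
Qed.

Lemma is_derive_Airy u : is_derive u 1 (@Airy R) (Airy' u).
Proof.
rewrite AiryE; apply: is_derive_by; eexists; split.
  notypeclasses refine (@is_derive_mulf _ (fun=> pi^-1) _ _ _ _ _ _); first deriv_step.
  exact: is_derive_int_airy_moment.
by rewrite /Airy' mul0r add0r mulrN.
Qed.

(** This is Airy's equation in integral form. After two derivatives the phase is [pi], and
    [t^2 e^{i pi} - u e^{i pi/3}] is the logarithmic derivative of [exp (- t^3/3 - u t e^{i pi/3})],
    whose imaginary part vanishes at [t = 0]. *)
Lemma Airy_second_moment u :
  Rintegral mu Ry (airy_moment 2 (pi / 3 + (pi / 3 + pi / 3)) u) =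
  u * Rintegral mu Ry (airy_moment 0 (pi / 3) u).
Proof.
have E3 : pi / 3 + (pi / 3 + pi / 3) = pi :> R by field.
have [C2 h2] := airy_moment_dominated 2 u.
have [C0 h0] := airy_moment_dominated 0 u.
have u0 : `|u - u| < 1 by rewrite subrr normr0.
have I2 := exp_dominated_integrable mRy (@continuous_airy_moment 2 pi u) (h2 pi u u0).
have I0 := exp_dominated_integrable mRy (@continuous_airy_moment 0 (pi / 3) u) (h0 (pi / 3) u u0).
have c2 := @continuous_airy_moment 2 pi u; have c0 := @continuous_airy_moment 0 (pi / 3) u.
rewrite E3; apply/eqP; rewrite -subr_eq0 -RintegralZl //; apply/eqP.
rewrite -RintegralB //; last first.
  by have := integrableZl mRy u I0; apply: eq_integrable => // x _ /=; rewrite EFinM.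
have hC : exp_dominated Ry (C2 + `|u| * C0)
    (fun x => airy_moment 2 pi u x - u * airy_moment 0 (pi / 3) u x).
  move=> t Dt; rewrite [leRHS]mulrDl; apply: le_trans (ler_normB _ _) _; apply: lerD; first exact: h2.
  by rewrite normrM -mulrA ler_wpM2l //; exact: h0.
have cg : continuous (fun x => airy_moment 2 pi u x - u * airy_moment 0 (pi / 3) u x).
  move=> t; apply: cvgB; first exact: c2.
  by apply: cvgM; [exact: cvg_cst|exact: c0].
have dG t : is_derive t 1 (airy_moment 0 0 u)
    (airy_moment 2 pi u t - u * airy_moment 0 (pi / 3) u t).
  rewrite /airy_moment; apply: is_derive_by.
  have -> : (fun t => t ^+ 0 * (expR (- (t ^+ 3) / 3 - u * t / 2) * sin (0 - k * u * t)))
    = (fun t => (expR (- (t ^+ 3) / 3 - u * t / 2) * sin (- (k * u * t)))).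
    by apply/funext => z; rewrite expr0 mul1r sub0r.
  eexists; split; first solve [repeat deriv_step].
  rewrite sinD_pi_third expr0 -[pi - _]addrC sinDpi.
  by field.
rewrite (Rintegral_derive_0y cg dG hC (h0 0 u u0)).
by rewrite /airy_moment !(mulr0, subr0) sin0 !mulr0 oppr0.
Qed.

Lemma is_derive_Airy' u : is_derive u 1 Airy' (u * Airy u).
Proof.
rewrite /Airy' AiryE; apply: is_derive_by; eexists; split.
  notypeclasses refine (@is_derive_oppf _ _ _ _ _).
  notypeclasses refine (@is_derive_mulf _ (fun=> pi^-1) _ _ _ _ _ _); first deriv_step.
  exact: is_derive_int_airy_moment.
by rewrite mul0r add0r mulrN opprK Airy_second_moment; ring.
Qed.

Lemma continuous_Airy : continuous (@Airy R).
Proof. by apply: is_derive_continuous => u; exists (Airy' u); exact: is_derive_Airy. Qed.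

(** Starting the ray at [s = 2] brings out the factor [exp (8/3 - 2 u)]. A rate above 1 leaves room
    for the factor [u] in [Airy'' = u Airy]. *)
Lemma Airy_bound u0 : exists2 C : R, 0 <= C &
  forall u, u0 <= u -> `|Airy u| <= C * expR (- (2 * u)).
Proof.
have [C C0 hC] := expR_cubic_dominated ((4 - u0) / 2) 0.
pose I := Rintegral mu setT (fun t : R => expR (- `|t|)).
have I0 : 0 <= I by apply: Rintegral_ge0 => t _; exact: expR_ge0.
exists (pi^-1 * (expR (8 / 3) * C * I)).
  by rewrite !mulr_ge0 ?expR_ge0 // invr_ge0 pi_ge0.
move=> u hu; rewrite (Airy_ray 2 u) normrM (ger0_norm (_ : 0 <= pi^-1)); last first.
  by rewrite invr_ge0 pi_ge0.
rewrite -[leRHS]mulrA ler_wpM2l ?invr_ge0 ?pi_ge0 //.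
have hd : exp_dominated Ry (expR (8 / 3 - 2 * u) * C) (airy_ray (pi / 3) 2 u).
  move=> t; rewrite /= in_itv /= andbT => t0.
  rewrite (le_trans (airy_ray_bound _ _ _ _)) // -[leRHS]mulrA.
  apply: le_trans (ler_wpM2l (expR_ge0 _) (hC t t0)).
  rewrite -expRD ler_expR.
  have := ler_wpM2r t0 hu; have := sqr_ge0 t; lra.
have hC0 : 0 <= expR (8 / 3 - 2 * u) * C by rewrite mulr_ge0 ?expR_ge0.
apply: le_trans (exp_dominated_Rintegral mRy (@continuous_airy_ray _ _ _) hC0 hd) _.
by rewrite expRD -/I; lra.
Qed.

(* The bound on [Airy'] comes from the mean value theorem applied to [Airy] and [Airy']. *)
Lemma Airy_Airy'_bound u0 : exists2 C : R, 0 <= C &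
  forall u, u0 <= u -> `|Airy u| <= C * expR (- u) /\ `|Airy' u| <= C * expR (- u).
Proof.
have [C C0 hC] := Airy_bound u0.
(* Half of the decay absorbs the factor [1 + |v|], which covers both [Airy v] and [v Airy v]. *)
have key v : u0 <= v -> (1 + `|v|) * expR (- (2 * v)) <=
    (1 + `|u0|) * expR `|u0| * expR (- v).
  move=> hv.
  have h1 : 0 <= v + `|u0| by have := ler_norm (- u0); rewrite normrN; lra.
  have h2 : 1 + `|v| <= (1 + `|u0|) * expR (v + `|u0|).
    have := expR_ge1Dx (v + `|u0|) => h3.
    have h4 : `|v| <= v + `|u0| + `|u0|.
      by have := ler_normB (v + `|u0|) `|u0|; rewrite addrK (ger0_norm h1) normr_id.
    have := ler_wpM2l (addr_ge0 ler01 (normr_ge0 u0)) h3.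
    have := mulr_ge0 (normr_ge0 u0) h1; lra.
  have := ler_wpM2r (expR_ge0 (- (2 * v))) h2; rewrite -!mulrA -!expRD.
  by congr (_ <= _ * expR _); lra.
pose K := (1 + `|u0|) * expR `|u0|.
have K0 : 0 <= K by rewrite mulr_ge0 ?expR_ge0 ?addr_ge0.
have b0 v : u0 <= v -> `|Airy v| <= C * K * expR (- v).
  move=> hv; rewrite (le_trans (hC v hv)) // -mulrA ler_wpM2l // (le_trans _ (key v hv)) //.
  by rewrite ler_peMl ?expR_ge0 // lerDl.
have b1 v : u0 <= v -> `|v * Airy v| <= C * K * expR (- v).
  move=> hv; rewrite normrM -mulrA (le_trans (ler_wpM2l (normr_ge0 v) (hC v hv))) //.
  rewrite mulrCA ler_wpM2l // (le_trans _ (key v hv)) // ler_wpM2r ?expR_ge0 //.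
  by rewrite lerDr.
have CK : 0 <= C * K by rewrite mulr_ge0.
exists (3 * (C * K)); first by rewrite mulr_ge0.
move=> u hu; have e u' : u <= u' -> C * K * expR (- u') <= C * K * expR (- u).
  by move=> uu'; rewrite ler_wpM2l // ler_expR lerN2.
have CE : 0 <= C * K * expR (- u) by rewrite mulr_ge0 ?expR_ge0.
split; first by have := b0 u hu; lra.
have u1 : u < u + 1 by rewrite ltrDl.
have [c1 /andP[uc1 c1u] E1] := is_derive_MVT is_derive_Airy u1.
have [c2 /andP[uc2 c2c1] E2] := is_derive_MVT is_derive_Airy' uc1.
have -> : Airy' u = Airy (u + 1) - Airy u - c2 * Airy c2 * (c1 - u).
  by rewrite E1 -E2; lra.
have B1 := b0 (u + 1) (le_trans hu (ltW u1)).
have B2 := b0 u hu.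
have B3 := b1 c2 (le_trans hu (ltW uc2)).
have B3' : `|c2 * Airy c2 * (c1 - u)| <= C * K * expR (- c2).
  rewrite normrM (le_trans _ B3) // ler_piMr // ger0_norm ?subr_ge0; lra.
have := e _ (ltW u1); have := e _ (ltW uc2).
have := ler_normB (Airy (u + 1) - Airy u) (c2 * Airy c2 * (c1 - u)).
have := ler_normB (Airy (u + 1)) (Airy u).
lra.
Qed.

(** At [u = 0] the phase no longer depends on [t], so the integrand is positive; its integral over
    [[0, 1]] is already bounded below. *)
Lemma Airy0_gt0 : 0 < Airy (0 : R).
Proof.
have [C hC] := airy_moment_dominated 0 0.
have h0 : exp_dominated Ry C (airy_moment 0 (pi / 3) 0) by apply: hC; rewrite subrr normr0.
have cM := @continuous_airy_moment 0 (pi / 3) 0.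
have IM := exp_dominated_integrable mRy cM h0.
have s0 : 0 < sin (pi / 3 : R).
  by rewrite sin_pi_third divr_gt0 // sqrtr_gt0.
have E t : airy_moment 0 (pi / 3) 0 t = expR (- (t ^+ 3) / 3) * sin (pi / 3).
  by rewrite /airy_moment expr0 mul1r !(mul0r, mulr0, subr0).
rewrite AiryE mulr_gt0 ?invr_gt0 ?pi_gt0 //.
have m1 : @measurable _ (measurableTypeR R) `[0%R, 1%R]%classic by exact: measurable_itv.
have m2 : @measurable _ (measurableTypeR R) `]1%R, +oo[%classic by exact: measurable_itv.
have sub1 : `[0%R, 1%R]%classic `<=` Ry.
  by move=> x /=; rewrite !in_itv /= => /andP[->].
have I1 : mu.-integrable `[0%R, 1%R]%classic (EFin \o airy_moment 0 (pi / 3) 0).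
  exact: integrableS IM.
have := @Rintegral_itvB R (airy_moment 0 (pi / 3) 0) (BLeft 0) +oo%O 1 IM.
rewrite /= => /(_ _ _)/eqP; rewrite subr_eq => /(_ _ _)/eqP -> //; last by rewrite bnd_simp.
rewrite ltr_wpDl //.
  by apply: Rintegral_ge0 => t _; rewrite E mulr_ge0 ?expR_ge0 // ltW.
apply: (@lt_le_trans _ _ (expR (- (1 / 3)) * sin (pi / 3))).
  by rewrite mulr_gt0 ?expR_gt0.
have -> : expR (- (1 / 3)) * sin (pi / 3) =
   Rintegral mu `[0%R, 1%R]%classic (fun=> expR (- (1 / 3)) * sin (pi / 3)).
  by rewrite Rintegral_cst //= lebesgue_measure_itv /= lte_fin ltr01 /= subr0 mulr1.
apply: le_Rintegral => //.
  apply: continuous_compact_integrable; first exact: segment_compact.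
  by apply: continuous_subspaceT; exact: cst_continuous.
move=> t /=; rewrite in_itv /= => /andP[t0 t1]; rewrite E ler_wpM2r ?(ltW s0) // ler_expR.
have : t ^+ 3 <= 1 by rewrite exprn_ile1.
lra.
Qed.

(* If the last zero [a1] were nonnegative, [Airy^2] would be nondecreasing
   on [a1, +oo[ while vanishing at both ends. *)
Lemma Airy_last_zero_lt0 (a1 : R) : Airy a1 = 0 ->
  (forall t, Airy t = 0 -> t <= a1) -> a1 < 0.
Proof.
move=> z1 hz; rewrite ltNge; apply/negP => a0.
have mono (f df : R -> R) : (forall x : R, is_derive x 1 f (df x)) ->
    (forall x, a1 <= x -> 0 <= df x) ->
    forall x y, a1 <= x -> x <= y -> f x <= f y.
  move=> hd h0 x y ax; rewrite le_eqVlt => /orP[/eqP -> //|xy].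
  have [c /andP[xc cy] E] := is_derive_MVT hd xy.
  rewrite -subr_ge0 E mulr_ge0 ?subr_ge0 ?(ltW xy) // h0 //.
  exact: le_trans ax (ltW xc).
(* By Airy's equation this derivative is nonnegative for [x >= a1 >= 0], so [Airy Airy'] stays
   nonnegative from its zero [a1] on, and [Airy^2] does not decrease. *)
have d1 (x : R) : is_derive x 1 (fun x => Airy x * Airy' x)
    (Airy' x ^+ 2 + x * Airy x ^+ 2).
  apply: is_derive_by; eexists; split.
    exact: is_derive_mulf (is_derive_Airy x) (is_derive_Airy' x).
  by ring.
have d2 (x : R) : is_derive x 1 (fun x => Airy x * Airy x) (2 * (Airy x * Airy' x)).
  apply: is_derive_by; eexists; split.
    exact: is_derive_mulf (is_derive_Airy x) (is_derive_Airy x).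
  by ring.
have p1 x : a1 <= x -> 0 <= Airy x * Airy' x.
  move=> ax; have := mono _ _ d1 _ a1 x (lexx _) ax.
  rewrite /= z1 mul0r; apply => y ay.
  apply: addr_ge0; first exact: sqr_ge0.
  by apply: mulr_ge0; [exact: le_trans a0 ay|exact: sqr_ge0].
have p2 x : a1 + 1 <= x -> Airy (a1 + 1) ^+ 2 <= Airy x ^+ 2.
  move=> ax; rewrite !expr2; apply: (mono _ _ d2) => //; last by rewrite lerDl.
  by move=> y ay; rewrite mulr_ge0 // p1.
have [C C0 hC] := Airy_bound 0.
have az : Airy (a1 + 1) != 0.
  by apply/eqP => /hz; rewrite gerDl ler10.
have az2 : 0 < Airy (a1 + 1) ^+ 2 by rewrite exprn_even_gt0.
set e := Airy (a1 + 1) ^+ 2 in p2 az2.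
(* Chosen so that [exp x > C^2 / e]; the decay bound then pushes [Airy x ^+ 2] below [e]. *)
pose x := a1 + 1 + C ^+ 2 / e.
have x0 : 0 <= C ^+ 2 / e by rewrite divr_ge0 ?sqr_ge0 // ltW.
have ax : a1 + 1 <= x by rewrite lerDl.
have xx : 0 <= x by rewrite (le_trans _ ax) // addr_ge0.
have := p2 x ax; rewrite leNgt => /negP; apply.
apply: (@le_lt_trans _ _ (C ^+ 2 * expR (- x))).
  rewrite -(real_normK (num_real (Airy x))).
  apply: (@le_trans _ _ ((C * expR (- (2 * x))) ^+ 2)).
    by rewrite lerXn2r ?nnegrE ?mulr_ge0 ?expR_ge0 // hC.
  by rewrite exprMn ler_wpM2l ?sqr_ge0 // -expRM_natl ler_expR; lra.
have : C ^+ 2 / e < expR x by apply: lt_le_trans (expR_ge1Dx x); rewrite /x; lra.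
by rewrite ltr_pdivrMr // => h; rewrite expRN ltr_pdivrMr ?expR_gt0 // mulrC.
Qed.

(** As [a1 < 0], both 0 and [u] lie beyond the last zero. By the intermediate value theorem [Airy]
    has the same sign at both. *)
Lemma Airy_gt0 (a1 u : R) : Airy a1 = 0 ->
  (forall t, Airy t = 0 -> t <= a1) -> a1 < u -> 0 < Airy u.
Proof.
move=> z1 hz a1u; have a10 := Airy_last_zero_lt0 z1 hz; have A0 := Airy0_gt0.
rewrite ltNge; apply/negP => Au.
have [u0|u0] := leP u 0.
  have [|c hc Ac] := @IVT R (@Airy R) u 0 0 u0 (continuous_subspaceT continuous_Airy).
    by rewrite ge_min Au le_max (ltW A0) orbT.
  have := hz c Ac; rewrite leNgt (lt_le_trans a1u) //.
  by move: hc; rewrite in_itv /= => /andP[].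
have [|c hc Ac] := @IVT R (@Airy R) 0 u 0 (ltW u0) (continuous_subspaceT continuous_Airy).
  by rewrite ge_min Au orbT le_max (ltW A0).
have := hz c Ac; rewrite leNgt (lt_le_trans a10) //.
by move: hc; rewrite in_itv /= => /andP[].
Qed.

End AiryFunction.

(** * A rotated Gaussian integral *)

Section GaussianRotation.
Variable R : realType.
Notation mu := (@lebesgue_measure R).
Notation Ry := (`[0%R, +oo[%classic : set R).
Implicit Types th t : R.

Let mRy : @measurable _ (measurableTypeR R) Ry.
Proof. exact: measurable_itv. Qed.

(* Real part of [e^{i th} exp (- (t e^{i th})^2)]. *)
Definition rotated_gauss th t :=
  expR (- (t ^+ 2 * cos (2 * th))) * cos (th - t ^+ 2 * sin (2 * th)).

Definition rotated_gauss_d th t :=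
  expR (- (t ^+ 2 * cos (2 * th))) *
  (2 * t ^+ 2 * sin (2 * th) * cos (th - t ^+ 2 * sin (2 * th)) -
   (1 - 2 * t ^+ 2 * cos (2 * th)) * sin (th - t ^+ 2 * sin (2 * th))).

(** Real part of [i z exp (- z^2)] at [z = t e^{i th}]; its [t]-derivative is the [th]-derivative of
    [e^{i th} exp (- z^2)]. *)
Definition rotated_gauss_primitive th t :=
  - (t * expR (- (t ^+ 2 * cos (2 * th))) * sin (th - t ^+ 2 * sin (2 * th))).

Lemma is_derive_rotated_gauss_th th t :
  is_derive th 1 (rotated_gauss ^~ t) (rotated_gauss_d th t).
Proof. by rewrite /rotated_gauss /rotated_gauss_d; deriv; ring. Qed.

Lemma is_derive_rotated_gauss_primitive th t :
  is_derive t 1 (rotated_gauss_primitive th) (rotated_gauss_d th t).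
Proof. by rewrite /rotated_gauss_primitive /rotated_gauss_d; deriv; ring. Qed.

Lemma rotated_gauss_dominated : exists C, forall th, 1 / 4 <= cos (2 * th) ->
  [/\ exp_dominated Ry C (rotated_gauss th),
      exp_dominated Ry C (rotated_gauss_d th) &
      exp_dominated Ry C (rotated_gauss_primitive th)].
Proof.
(* The rate [1/4] is the lower bound on the cosine, and the linear term pays for [expR (2 * t)],
   which bounds [1], [t] and [t^2]. The 5 below comes from the bound [1 + 4 t^2] for the factor in
   [rotated_gauss_d]. *)
have [C C0 hC] := @expR_gauss_dominated R 2 (1 / 4) ltac:(lra).
exists (5 * C) => th hth.
have key (g : R) t : 0 <= t -> `|g| <= 5 * expR (2 * t) ->
    `|expR (- (t ^+ 2 * cos (2 * th))) * g| <= 5 * C * expR (- `|t|).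
  move=> t0 hg; rewrite normrM (ger0_norm (expR_ge0 _)).
  apply: (@le_trans _ _ (expR (- (t ^+ 2 * cos (2 * th))) * (5 * expR (2 * t)))).
    by rewrite ler_wpM2l ?expR_ge0.
  rewrite mulrCA -mulrA ler_wpM2l // -expRD (le_trans _ (hC t)) // ler_expR ger0_norm //.
  have := ler_wpM2l (sqr_ge0 t) hth; lra.
have aux t : 0 <= t -> [/\ 1 <= expR (2 * t), t <= expR (2 * t) & t ^+ 2 <= expR (2 * t)].
  move=> t0; have h1 : 1 <= expR t by rewrite -expR0 ler_expR.
  have h2 : t <= expR t by have := norm_le_expR t; rewrite ger0_norm.
  have -> : expR (2 * t) = expR t ^+ 2 by rewrite expRM_natl.
  split; first by rewrite expr_ge1.
    by rewrite (le_trans h2) // expr2 ler_peMl // expR_ge0.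
  by rewrite lerXn2r ?nnegrE ?expR_ge0.
split=> t; rewrite /= in_itv /= andbT => t0; have [a1 a2 a3] := aux t t0.
- by apply: key => //; apply: le_trans (cos_max _) _; lra.
- apply: key => //; apply: le_trans (ler_normB _ _) _.
  have h1 : `|2 * t ^+ 2 * sin (2 * th) * cos (th - t ^+ 2 * sin (2 * th))| <= 2 * t ^+ 2.
    rewrite -mulrA normrM ger0_norm ?mulr_ge0 ?sqr_ge0 // ler_piMr ?mulr_ge0 ?sqr_ge0 //.
    by rewrite normrM mulr_ile1 ?sin_max ?cos_max.
  have h2 : `|(1 - 2 * t ^+ 2 * cos (2 * th)) * sin (th - t ^+ 2 * sin (2 * th))| <= 1 + 2 * t ^+ 2.
    rewrite normrM (le_trans (ler_piMr _ (sin_max _))) //.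
    rewrite (le_trans (ler_normB _ _)) // normr1 lerD2l normrM.
    by rewrite ger0_norm ?mulr_ge0 ?sqr_ge0 // ler_piMr ?mulr_ge0 ?sqr_ge0 ?cos_max.
  lra.
- rewrite /rotated_gauss_primitive normrN -mulrA mulrCA; apply: key => //.
  rewrite normrM ger0_norm // (le_trans (ler_piMr _ (sin_max _))) //; lra.
Qed.

Lemma continuous_rotated_gauss th : continuous (rotated_gauss th).
Proof. by rewrite /rotated_gauss; deriv_continuous. Qed.

(** Supplies the neighbourhood with uniform Gaussian decay that differentiation under the integral
    requires: [cos (2 th)] is 2-Lipschitz, so it loses at most [1/4]. *)
Lemma cos_double_near th th0 : 1 / 2 <= cos (2 * th0) -> `|th - th0| < 1 / 8 ->
  1 / 4 <= cos (2 * th).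
Proof.
move=> h0 h.
have d (x : R) : is_derive x 1 (fun x => cos (2 * x)) (- (2 * sin (2 * x))).
  by deriv; ring.
suff : `|cos (2 * th) - cos (2 * th0)| <= 2 * `|th - th0|.
  by rewrite ler_norml => /andP[? ?]; lra.
wlog le : th th0 {h0 h} / th0 < th.
  move=> H; have [/H //|/H|->] := ltgtP th0 th; last by rewrite !subrr normr0 mulr0.
  by rewrite distrC [X in _ -> _ <= 2 * X]distrC.
have [c _ ->] := is_derive_MVT d le.
rewrite normrM normrN normrM ler_wpM2r // ger0_norm // ler_piMr //; exact: sin_max.
Qed.

Lemma is_derive_int_rotated_gauss th : 1 / 2 <= cos (2 * th) ->
  is_derive th 1 (fun th => Rintegral mu Ry (rotated_gauss th)) 0.
Proof.
move=> hth; have [C hC] := rotated_gauss_dominated.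
have hth' : 1 / 4 <= cos (2 * th) by lra.
apply: is_derive_by; eexists; split.
  apply: (@is_derive_exp_dominated _ Ry C rotated_gauss rotated_gauss_d _ (1 / 8)) => //.
  - by move=> x; exact: continuous_rotated_gauss.
  - by move=> x hx; exists C; have [] := hC x (cos_double_near hth hx).
  - by move=> x t _; exact: is_derive_rotated_gauss_th.
  - by move=> x hx; have [] := hC x (cos_double_near hth hx).
have cd : continuous (rotated_gauss_d th) by rewrite /rotated_gauss_d; deriv_continuous.
have [_ hd hp] := hC th hth'.
rewrite (Rintegral_derive_0y cd (is_derive_rotated_gauss_primitive th) hd hp).
by rewrite /rotated_gauss_primitive !mul0r oppr0 oppr0.
Qed.

Lemma Rintegral_gauss_0y : Rintegral mu Ry (fun t : R => expR (- t ^+ 2)) = Num.sqrt pi / 2.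
Proof. by rewrite /Rintegral integral0y_gauss. Qed.

Lemma Rintegral_gauss_T : Rintegral mu setT (fun t : R => expR (- t ^+ 2)) = Num.sqrt pi.
Proof. by rewrite /Rintegral integralT_gauss. Qed.

(* Rotating the contour by [- pi/6] turns the Gaussian integral into this one. *)
Lemma Rintegral_gauss_sin : Rintegral mu Ry (fun t : R =>
  expR (- (t ^+ 2 / 2)) * sin (pi / 3 + Num.sqrt 3 / 2 * t ^+ 2)) = Num.sqrt pi / 2.
Proof.
have p0 := pi_gt0 R.
have E1 : Rintegral mu Ry (rotated_gauss (- (pi / 6))) = Rintegral mu Ry (rotated_gauss 0).
  (* Throughout the rotation [cos (2 th)] stays at least [1/2], its value at the endpoint
     [- pi / 6], so the Gaussian decay persists. *)
  pose f th := Rintegral mu Ry (rotated_gauss th).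
  have hcos th : - (pi / 6) <= th <= 0 -> 1 / 2 <= cos (2 * th).
    move=> /andP[h1 h2]; rewrite -cosN -cos_pi_third.
    rewrite leNgt ltr_cos ?in_itv /=; [|apply/andP; split; lra..].
    by rewrite -leNgt; lra.
  have hd th : - (pi / 6) <= th <= 0 -> is_derive th 1 f 0.
    by move=> /hcos; exact: is_derive_int_rotated_gauss.
  have hlt : - (pi / 6) < 0 :> R by lra.
  have [th||c _ E] := @MVT R f (fun=> 0) (- (pi / 6)) 0 hlt _ _.
  - rewrite in_itv /= => /andP[h1 h2]; apply: hd; by rewrite (ltW h1) (ltW h2).
  - apply: derivable_within_continuous => th; rewrite in_itv /= => h.
    by case: (hd th h).
  by apply/esym/eqP; rewrite -subr_eq0 E mul0r.
transitivity (Rintegral mu Ry (rotated_gauss (- (pi / 6)))).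
  apply: eq_Rintegral => t _; rewrite /rotated_gauss.
  have -> : 2 * - (pi / 6) = - (pi / 3) :> R by field.
  rewrite cosN sinN cos_pi_third sin_pi_third.
  have -> : - (pi / 6) - t ^+ 2 * - (Num.sqrt 3 / 2) = Num.sqrt 3 / 2 * t ^+ 2 - pi / 6 by ring.
  rewrite -sinDpihalf; congr (expR _ * sin _); first by field.
  by field.
rewrite E1 -Rintegral_gauss_0y; apply: eq_Rintegral => t _.
by rewrite /rotated_gauss !(mulr0, sin0, cos0, mulr1, subr0).
Qed.

End GaussianRotation.

(** * The differential equation of the kernel integral *)

Section Tempered.
Variables (R : realType) (X : R).
Implicit Types p q : R -> R -> R.

(** Exponential growth in [z], uniform for bounded [x]. This class is closed under sums and products
    and is absorbed by the Gaussian decay of the kernel in [z]. *)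
Definition tempered p := exists P N : R, [/\ 0 <= P, 0 <= N &
  forall x z, `|x| <= X -> `|p x z| <= P * expR (N * `|z|)].

Lemma tempered_cst (c : R) : tempered (fun _ _ => c).
Proof. by exists `|c|, 0; split=> // x z _; rewrite mul0r expR0 mulr1. Qed.

Lemma tempered_fst : tempered (fun x _ => x).
Proof.
exists `|X|, 0; split=> // x z hx; rewrite mul0r expR0 mulr1.
by rewrite (le_trans hx) // ler_norm.
Qed.

Lemma tempered_snd : tempered (fun _ z => z).
Proof. by exists 1, 1; split=> // x z _; rewrite !mul1r norm_le_expR. Qed.

Lemma tempered_opp p : tempered p -> tempered (fun x z => - p x z).
Proof.
by move=> [P [N [P0 N0 h]]]; exists P, N; split=> // x z hx; rewrite normrN h.
Qed.

Lemma tempered_add p q : tempered p -> tempered q ->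
  tempered (fun x z => p x z + q x z).
Proof.
move=> [P [N [P0 N0 h]]] [Q [M [Q0 M0 k]]]; exists (P + Q), (N + M).
split; [exact: addr_ge0|exact: addr_ge0|move=> x z hx].
rewrite (le_trans (ler_normD _ _)) // mulrDl; apply: lerD.
  apply: le_trans (h x z hx) _; rewrite ler_wpM2l // ler_expR ler_wpM2r //.
  by rewrite lerDl.
apply: le_trans (k x z hx) _; rewrite ler_wpM2l // ler_expR ler_wpM2r //.
by rewrite lerDr.
Qed.

Lemma tempered_mul p q : tempered p -> tempered q ->
  tempered (fun x z => p x z * q x z).
Proof.
move=> [P [N [P0 N0 h]]] [Q [M [Q0 M0 k]]]; exists (P * Q), (N + M).
split; [exact: mulr_ge0|exact: addr_ge0|move=> x z hx].
by rewrite normrM mulrDl expRD mulrACA ler_pM // ?h ?k.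
Qed.

Lemma tempered_exp p n : tempered p -> tempered (fun x z => p x z ^+ n).
Proof.
move=> hp; elim: n => [|n IH].
  by have -> : (fun x z => p x z ^+ 0) = (fun _ _ => 1) by []; exact: tempered_cst.
have -> : (fun x z => p x z ^+ n.+1) = (fun x z => p x z * p x z ^+ n).
  by apply/funext => x; apply/funext => z; rewrite exprS.
exact: tempered_mul.
Qed.

End Tempered.

Ltac tempered_step :=
  lazymatch goal with
  | |- tempered _ (fun _ _ => ?c) => exact: tempered_cst
  | |- tempered _ (fun x _ => x) => exact: tempered_fst
  | |- tempered _ (fun _ z => z) => exact: tempered_snd
  | |- tempered ?X (fun x z => GRing.add (@?p x z) (@?q x z)) =>
      refine (@tempered_add _ X p q _ _)
  | |- tempered ?X (fun x z => GRing.opp (@?p x z)) =>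
      refine (@tempered_opp _ X p _)
  | |- tempered ?X (fun x z => GRing.mul (@?p x z) (@?q x z)) =>
      refine (@tempered_mul _ X p q _ _)
  | |- tempered ?X (fun x z => GRing.exp (@?p x z) ?n) =>
      refine (@tempered_exp _ X p n _)
  | |- tempered _ _ => assumption
  end.

Ltac airy_deriv_step :=
  first [deriv_step |
  lazymatch goal with
  | |- is_derive ?x _ (fun t => Airy (@?f t)) _ =>
      notypeclasses refine (@is_derive_compf _ (@Airy _) f x _ _ (is_derive_Airy _) _)
  | |- is_derive ?x _ (fun t => Airy' (@?f t)) _ =>
      notypeclasses refine (@is_derive_compf _ (@Airy' _) f x _ _ (is_derive_Airy' _) _)
  end].
Ltac airy_deriv :=
  apply: is_derive_by; eexists; split; [solve [repeat airy_deriv_step]|rewrite /=].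
Ltac airy_deriv_continuous :=
  apply: is_derive_continuous => ?; eexists; solve [repeat airy_deriv_step].

(* With [lambda = 8 r^12] one has [lambda^(1/3) = 2 r^4], [lambda^(2/3) = 4 r^8]
   and [sqrt (lambda / 2) = 2 r^6], so that no radical remains. *)
Section KernelODE.
Variables (R : realType) (a r : R) (r_gt0 : 0 < r).
Notation mu := (@lebesgue_measure R).
Implicit Types x y z : R.

Definition karg x y z := r ^+ 4 * (x ^+ 2 + y ^+ 2 + z ^+ 2) + a / (4 * r ^+ 8).
Definition kexp x y z := expR (2 * r ^+ 6 * (x * y * z)).
Definition kern x y z := 2 * r ^+ 4 * (kexp x y z * Airy (karg x y z)).
Definition kern1 x y z := 2 * r ^+ 4 * (kexp x y z *
  (2 * r ^+ 6 * (y * z) * Airy (karg x y z) + 2 * r ^+ 4 * x * Airy' (karg x y z))).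
Definition kern2 x y z := 2 * r ^+ 4 * (kexp x y z *
  ((4 * r ^+ 12 * (y * z) ^+ 2 + 4 * r ^+ 8 * x ^+ 2 * karg x y z) * Airy (karg x y z)
   + (8 * r ^+ 10 * (x * y * z) + 2 * r ^+ 4) * Airy' (karg x y z))).
Definition pot x := a * x ^+ 2 + 4 * r ^+ 12 * x ^+ 4.

Lemma is_derive_kern x y z : is_derive x 1 (fun x => kern x y z) (kern1 x y z).
Proof. by rewrite /kern /kern1 /kexp /karg; airy_deriv; ring. Qed.

Lemma is_derive_kern1 x y z : is_derive x 1 (fun x => kern1 x y z) (kern2 x y z).
Proof. by rewrite /kern1 /kern2 /kexp /karg; airy_deriv; ring. Qed.

Lemma kargC x y z : karg x y z = karg z y x. Proof. by rewrite /karg; congr (_ * _ + _); ring. Qed.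
Lemma kexpC x y z : kexp x y z = kexp z y x. Proof. by rewrite /kexp; congr expR; ring. Qed.
Lemma kernC x y z : kern x y z = kern z y x.
Proof. by rewrite /kern kargC kexpC. Qed.

Lemma is_derive_kern_z x y z : is_derive z 1 (fun z => kern x y z) (kern1 z y x).
Proof.
have -> : (fun z => kern x y z) = (fun z => kern z y x) by apply/funext => w; exact: kernC.
exact: is_derive_kern.
Qed.

(* [kern2 - V kern] is a symmetric function of [x], [y], [z]. *)
Lemma kern2_symmetry x y z :
  kern2 x y z = kern2 z y x + (pot x - pot z) * kern x y z.
Proof.
rewrite /kern2 /kern (kargC z y x) (kexpC z y x) /pot.
set A := Airy _; set B := Airy' _; set e := kexp _ _ _; rewrite /karg.
by field; rewrite gt_eqF.
Qed.

(** The kernel and its derivatives all have this shape, with polynomial [p] and [q]. Since [karg] is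
    at least [r^4 z^2] plus a constant, the exponential decay of [Airy] and [Airy'] becomes Gaussian
    decay in [z], which beats the exponential factors. *)
Lemma kern_dominated (X y : R) (p q : R -> R -> R) : tempered X p -> tempered X q ->
  exists C, forall x, `|x| <= X -> exp_dominated setT C (fun z => kexp x y z *
    (p x z * Airy (karg x y z) + q x z * Airy' (karg x y z))).
Proof.
move=> [P [N [P0 N0 hp]]] [Q [M [Q0 M0 hq]]].
pose u0 := a / (4 * r ^+ 8).
have [C C0 hC] := Airy_Airy'_bound u0.
have r40 : 0 < r ^+ 4 by rewrite exprn_gt0.
pose L := 2 * r ^+ 6 * (`|X| * `|y|) + N + M.
have [C' C'0 hC'] := expR_gauss_dominated L r40.
exists ((P + Q) * (C * expR (- u0)) * C') => x hx z _.
have hk : karg x y z >= r ^+ 4 * z ^+ 2 + u0.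
  rewrite /karg lerD2r ler_pM2l //; have := sqr_ge0 x; have := sqr_ge0 y; lra.
have hk0 : u0 <= karg x y z.
  by apply: le_trans hk; rewrite lerDr mulr_ge0 ?sqr_ge0 // ltW.
have [hA hB] := hC _ hk0.
have he : C * expR (- karg x y z) <= C * expR (- u0) * expR (- (r ^+ 4 * z ^+ 2)).
  by rewrite -mulrA ler_wpM2l // -expRD ler_expR; lra.
have {}hA := le_trans hA he; have {}hB := le_trans hB he.
have hE : kexp x y z <= expR (2 * r ^+ 6 * (`|X| * `|y|) * `|z|).
  rewrite /kexp ler_expR -[leRHS]mulrA ler_wpM2l ?mulr_ge0 ?exprn_ge0 ?(ltW r_gt0) //.
  rewrite (le_trans (ler_norm _)) // !normrM ler_wpM2r // ler_wpM2r //.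
  by rewrite (le_trans hx) // ler_norm.
rewrite normrM (ger0_norm (expR_ge0 _)).
have hpq : `|p x z * Airy (karg x y z) + q x z * Airy' (karg x y z)| <=
   ((P + Q) * expR ((N + M) * `|z|)) * (C * expR (- u0) * expR (- (r ^+ 4 * z ^+ 2))).
  have h1 : `|p x z| <= P * expR ((N + M) * `|z|).
    by apply: le_trans (hp x z hx) _; rewrite ler_wpM2l // ler_expR ler_wpM2r // lerDl.
  have h2 : `|q x z| <= Q * expR ((N + M) * `|z|).
    by apply: le_trans (hq x z hx) _; rewrite ler_wpM2l // ler_expR ler_wpM2r // lerDr.
  apply: le_trans (ler_normD _ _) _; rewrite (normrM (p x z)) (normrM (q x z)).
  have g1 := ler_pM (normr_ge0 _) (normr_ge0 _) h1 hA.
  have g2 := ler_pM (normr_ge0 _) (normr_ge0 _) h2 hB.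
  by apply: le_trans (lerD g1 g2) _; rewrite -mulrDl -mulrDl.
apply: le_trans (ler_pM (expR_ge0 _) (normr_ge0 _) hE hpq) _.
apply: (@le_trans _ _ ((P + Q) * (C * expR (- u0)) * expR (L * `|z| - r ^+ 4 * z ^+ 2))); last first.
  by rewrite -[leRHS]mulrA ler_wpM2l // !mulr_ge0 ?addr_ge0 ?expR_ge0.
rewrite le_eqVlt; apply/orP; left; apply/eqP.
have -> : L * `|z| - r ^+ 4 * z ^+ 2 = 2 * r ^+ 6 * (`|X| * `|y|) * `|z| +
    ((N + M) * `|z| + - (r ^+ 4 * z ^+ 2)) by rewrite /L; ring.
by rewrite [expR (_ + (_ + _))]expRD [expR ((N + M) * _ + _)]expRD; ring.
Qed.

Variables (E : R) (psi dpsi : R -> R) (B : R).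
Hypothesis dpsi1 : forall x : R, is_derive x 1 psi (dpsi x).
Hypothesis dpsi2 : forall x : R, is_derive x 1 dpsi ((pot x - E) * psi x).
Hypothesis psiB : forall x, `|psi x| <= B.

Lemma continuous_psi : continuous psi.
Proof. by apply: is_derive_continuous => x; exists (dpsi x). Qed.

Lemma tempered_psi X : tempered X (fun _ z => psi z).
Proof.
exists `|B|, 0; split=> // x z _; rewrite mul0r expR0 mulr1.
by rewrite (le_trans (psiB z)) // ler_norm.
Qed.

(** The equation and the bound on [psi] control [dpsi']; the mean value theorem from 0 then controls
    [dpsi] at the cost of a factor [|z|], absorbed by raising [N] by 1. *)
Lemma tempered_dpsi X : tempered X (fun _ z => dpsi z).
Proof.
have : tempered 0 (fun _ z => (pot z - E) * psi z).
  have hp := tempered_psi 0; rewrite /pot; solve [repeat tempered_step].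
move=> [P [N [P0 N0 h]]].
have h' z : `|(pot z - E) * psi z| <= P * expR (N * `|z|) by apply: (h 0); rewrite normr0.
have main z : `|dpsi z - dpsi 0| <= P * expR (N * `|z|) * `|z|.
  have [z0|z0|->] := ltgtP z 0; last by rewrite subrr !normr0 mulr0.
    have [c /andP[c1 c2] e] := is_derive_MVT dpsi2 z0.
    rewrite distrC e sub0r normrM normrN ler_wpM2r // (le_trans (h' c)) // ler_wpM2l //.
    by rewrite ler_expR ler_wpM2l // (ltr0_norm z0) (ltr0_norm c2) lerN2 ltW.
  have [c /andP[c1 c2] e] := is_derive_MVT dpsi2 z0.
  rewrite e subr0 normrM ler_wpM2r // (le_trans (h' c)) // ler_wpM2l //.
  by rewrite ler_expR ler_wpM2l // (gtr0_norm z0) (gtr0_norm c1) ltW.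
exists (`|dpsi 0| + P), (N + 1); split; [exact: addr_ge0|exact: addr_ge0|move=> x z _].
rewrite -[dpsi z](subrK (dpsi 0)) (le_trans (ler_normD _ _)) // addrC mulrDl; apply: lerD.
  rewrite ler_peMr // -expR0 ler_expR mulr_ge0 // addr_ge0 //.
apply: le_trans (main z) _; rewrite -mulrA ler_wpM2l // mulrDl mul1r expRD.
by rewrite ler_wpM2l ?expR_ge0 // norm_le_expR.
Qed.

Definition kint y x := Rintegral mu setT (fun z => psi z * kern x y z).
Definition kint1 y x := Rintegral mu setT (fun z => psi z * kern1 x y z).

Lemma psi_kern_dominated X y : exists C, forall x, `|x| <= X ->
  exp_dominated setT C (fun z => psi z * kern x y z).
Proof.
have hp := tempered_psi X.
have [||C hC] := @kern_dominated X y (fun _ z => psi z * (2 * r ^+ 4)) (fun _ _ => 0).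
- by repeat tempered_step.
- exact: tempered_cst.
exists C => x hx z hz; apply: le_trans (hC x hx z hz); rewrite /kern.
by rewrite le_eqVlt; apply/orP; left; apply/eqP; congr (Num.norm _); ring.
Qed.

Lemma psi_kern1_dominated X y : exists C, forall x, `|x| <= X ->
  exp_dominated setT C (fun z => psi z * kern1 x y z).
Proof.
have hp := tempered_psi X.
have [||C hC] := @kern_dominated X y
   (fun _ z => psi z * (2 * r ^+ 4) * (2 * r ^+ 6 * (y * z)))
   (fun x z => psi z * (2 * r ^+ 4) * (2 * r ^+ 4 * x)).
- by repeat tempered_step.
- by repeat tempered_step.
exists C => x hx z hz; apply: le_trans (hC x hx z hz); rewrite /kern1.
by rewrite le_eqVlt; apply/orP; left; apply/eqP; congr (Num.norm _); ring.
Qed.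

Lemma psi_kern2_dominated X y : exists C, forall x, `|x| <= X ->
  exp_dominated setT C (fun z => psi z * kern2 x y z).
Proof.
have hp := tempered_psi X.
have [||C hC] := @kern_dominated X y
   (fun x z => psi z * (2 * r ^+ 4) * (4 * r ^+ 12 * (y * z) ^+ 2 + 4 * r ^+ 8 * x ^+ 2 * karg x y z))
   (fun x z => psi z * (2 * r ^+ 4) * (8 * r ^+ 10 * (x * y * z) + 2 * r ^+ 4)).
- by rewrite /karg; repeat tempered_step.
- by repeat tempered_step.
exists C => x hx z hz; apply: le_trans (hC x hx z hz); rewrite /kern2.
by rewrite le_eqVlt; apply/orP; left; apply/eqP; congr (Num.norm _); ring.
Qed.

Lemma continuous_kern x y : continuous (kern x y).
Proof. by rewrite /kern /kexp /karg; airy_deriv_continuous. Qed.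

Lemma continuous_kern1 x y : continuous (kern1 x y).
Proof. by rewrite /kern1 /kexp /karg; airy_deriv_continuous. Qed.

Lemma continuous_kern2 x y : continuous (kern2 x y).
Proof. by rewrite /kern2 /kexp /karg; airy_deriv_continuous. Qed.

Lemma continuous_psiM (g : R -> R) : continuous g -> continuous (fun z => psi z * g z).
Proof. by move=> cg z; apply: cvgM; [exact: continuous_psi|exact: cg]. Qed.

Let near_le x x0 : `|x - x0| < 1 -> `|x| <= `|x0| + 1.
Proof.
by move=> h; rewrite -[x](subrK x0) addrC (le_trans (ler_normD _ _)) // lerD2l ltW.
Qed.

Lemma is_derive_kint y x : is_derive x 1 (kint y) (kint1 y x).
Proof.
have [C hC] := psi_kern1_dominated (`|x| + 1) y.
notypeclasses refine (@is_derive_exp_dominated _ setT C (fun x z => psi z * kern x y z)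
  (fun x z => psi z * kern1 x y z) x 1 ltr01 measurableT _ _ _ _).
- by move=> w; apply: continuous_psiM; exact: continuous_kern.
- move=> w _; have [C' h] := psi_kern_dominated `|w| y; exists C'; exact: h.
- move=> w z _; apply: is_derive_by; eexists; split.
    notypeclasses refine (@is_derive_mulf _ (fun=> psi z) _ _ _ _ _ _); first deriv_step.
    exact: is_derive_kern.
  by rewrite /= mul0r add0r.
- by move=> w /near_le; exact: hC.
Qed.

Lemma kint1_derive y x :
  is_derive x 1 (kint1 y) (Rintegral mu setT (fun z => psi z * kern2 x y z)).
Proof.
have [C hC] := psi_kern2_dominated (`|x| + 1) y.
notypeclasses refine (@is_derive_exp_dominated _ setT C (fun x z => psi z * kern1 x y z)
  (fun x z => psi z * kern2 x y z) x 1 ltr01 measurableT _ _ _ _).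
- by move=> w; apply: continuous_psiM; exact: continuous_kern1.
- move=> w _; have [C' h] := psi_kern1_dominated `|w| y; exists C'; exact: h.
- move=> w z _; apply: is_derive_by; eexists; split.
    notypeclasses refine (@is_derive_mulf _ (fun=> psi z) _ _ _ _ _ _); first deriv_step.
    exact: is_derive_kern1.
  by rewrite /= mul0r add0r.
- by move=> w /near_le; exact: hC.
Qed.

(** Green's identity: the integrand is the [z]-derivative of [psi' K - psi K_z], which decays at
    both ends. *)
Lemma kernel_green y x :
  Rintegral mu setT (fun z => (pot z - E) * psi z * kern x y z - psi z * kern2 z y x) = 0.
Proof.
have hp := tempered_psi `|x|; have hdp := tempered_dpsi `|x|.
have [||C hC] := @kern_dominated `|x| y
   (fun x z => (pot z - E) * psi z * (2 * r ^+ 4) - psi z * (2 * r ^+ 4) *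
     (4 * r ^+ 12 * (y * x) ^+ 2 + 4 * r ^+ 8 * z ^+ 2 * karg x y z))
   (fun x z => - (psi z * (2 * r ^+ 4) * (8 * r ^+ 10 * (x * y * z) + 2 * r ^+ 4))).
- by rewrite /karg /pot; repeat tempered_step.
- by repeat tempered_step.
have [||C' hC'] := @kern_dominated `|x| y
   (fun x z => dpsi z * (2 * r ^+ 4) - psi z * (2 * r ^+ 4) * (2 * r ^+ 6 * (y * x)))
   (fun x z => - (psi z * (2 * r ^+ 4) * (2 * r ^+ 4 * z))).
- by repeat tempered_step.
- by repeat tempered_step.
have cg : continuous (fun z => (pot z - E) * psi z * kern x y z - psi z * kern2 z y x).
  move=> z; apply: cvgB; last first.
    apply: cvgM; first exact: continuous_psi.
    have : continuous (fun z => kern2 z y x).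
      by rewrite /kern2 /kexp /karg; airy_deriv_continuous.
    exact.
  apply: cvgM; last exact: continuous_kern.
  apply: cvgM; last exact: continuous_psi.
  have : continuous (fun z => pot z - E) by rewrite /pot; deriv_continuous.
  exact.
have dG z : is_derive z 1 (fun z => dpsi z * kern x y z - psi z * kern1 z y x)
    ((pot z - E) * psi z * kern x y z - psi z * kern2 z y x).
  apply: is_derive_by; eexists; split.
    notypeclasses refine (@is_derive_addf _ (fun z => dpsi z * kern x y z)
      (fun z => - (psi z * kern1 z y x)) _ _ _ _ _).
      notypeclasses refine (@is_derive_mulf _ dpsi (kern x y) _ _ _ (dpsi2 z) (is_derive_kern_z x y z)).
    notypeclasses refine (@is_derive_oppf _ (fun z => psi z * kern1 z y x) _ _ _).
    notypeclasses refine (@is_derive_mulf _ psi (fun z => kern1 z y x) _ _ _ (dpsi1 z) (is_derive_kern1 z y x)).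
  by rewrite /=; ring.
have hg : exp_dominated setT C (fun z => (pot z - E) * psi z * kern x y z - psi z * kern2 z y x).
  move=> z hz; apply: le_trans (hC x (lexx _) z hz); rewrite /kern2 /kern (kargC z) (kexpC z).
  by rewrite le_eqVlt; apply/orP; left; apply/eqP; congr (Num.norm _); ring.
have hG : exp_dominated setT C' (fun z => dpsi z * kern x y z - psi z * kern1 z y x).
  move=> z hz; apply: le_trans (hC' x (lexx _) z hz); rewrite /kern1 /kern (kargC z) (kexpC z).
  by rewrite le_eqVlt; apply/orP; left; apply/eqP; congr (Num.norm _); ring.
exact: (Rintegral_derive_T cg dG hg hG).
Qed.

Lemma integrable_psi_kern x y : mu.-integrable setT (EFin \o (fun z => psi z * kern x y z)).
Proof.
have [C hC] := psi_kern_dominated `|x| y.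
by apply: (@exp_dominated_integrable _ _ C) => //;
  [apply: continuous_psiM; exact: continuous_kern|exact: hC].
Qed.

Lemma is_derive_kint1 y x : is_derive x 1 (kint1 y) ((pot x - E) * kint y x).
Proof.
apply: is_derive_by; eexists; split; first exact: kint1_derive.
have I1 := integrable_psi_kern x y.
have [C hC] := psi_kern2_dominated `|x| y.
have I2 : mu.-integrable setT (EFin \o (fun z => psi z * kern2 x y z)).
  by apply: (@exp_dominated_integrable _ _ C) => //;
    [apply: continuous_psiM; exact: continuous_kern2|exact: hC].
have I3 : mu.-integrable setT (EFin \o (fun z => (pot x - E) * (psi z * kern x y z))).
  have := integrableZl measurableT (pot x - E) I1.
  by apply: eq_integrable => // z _ /=; rewrite EFinM.
rewrite /kint -RintegralZl //; apply/esym/eqP; rewrite -subr_eq0 -RintegralB //.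
(* Trading the second derivative in [x] for the one in [z] by [kern2_symmetry] leaves exactly the
   integrand of [kernel_green]. *)
rewrite -[X in _ == X](kernel_green y x); apply/eqP.
by apply: eq_Rintegral => z _; rewrite (kern2_symmetry x y z); ring.
Qed.

End KernelODE.

(** * Asymptotics of the kernel integral *)

Section KernelAsymptotics.
Variables (R : realType) (a r : R) (r_gt0 : 0 < r).
Notation mu := (@lebesgue_measure R).
Notation Ry := (`[0%R, +oo[%classic : set R).
Notation k := (Num.sqrt 3 / 2 : R).
Implicit Types (m q t v x y z : R).

Let mRy : @measurable _ (measurableTypeR R) Ry.
Proof. exact: measurable_itv. Qed.

Definition prof x := x^-1 * expR (- (2 * r ^+ 6) / 3 * x ^+ 3 - a / (2 * (2 * r ^+ 6)) * x).

(* [airy_ray] on the ray from [r^2 m^2], rescaled by [1/m] and freed of its exponential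
   factor; [q] is the argument of [Airy] minus [(r^2 m^2)^2]. *)
Definition ray_profile m q t :=
  expR (- (q * m^-1 / 2 * t) - r ^+ 2 / 2 * t ^+ 2 - m^-1 ^+ 3 * (t ^+ 3 / 3))
  * sin (pi / 3 + k * (r ^+ 2 * t ^+ 2 - q * m^-1 * t)).

Definition ray_int m q := Rintegral mu Ry (ray_profile m q).

Lemma continuous_ray_profile m q : continuous (ray_profile m q).
Proof. by rewrite /ray_profile; deriv_continuous. Qed.

(** For [m >= 1] the Gaussian term does not depend on [m], the cubic term only helps, and the linear
    coefficient [- q / m] is at most [|q0|]. *)
Lemma ray_profile_dominated q0 : exists2 C, 0 <= C &
  forall m q, 1 <= m -> q0 <= q -> exp_dominated Ry C (ray_profile m q).
Proof.
have r2 : 0 < r ^+ 2 / 2 by rewrite divr_gt0 ?exprn_gt0.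
have [C C0 hC] := expR_gauss_dominated (`|q0| / 2) r2.
exists C => // m q m1 hq t; rewrite /= in_itv /= andbT => t0.
have m0 : 0 < m by rewrite (lt_le_trans _ m1).
have i0 : 0 <= m^-1 by rewrite invr_ge0 ltW.
have i1 : m^-1 <= 1 by rewrite invf_le1.
rewrite /ray_profile normrM (ger0_norm (expR_ge0 _)).
rewrite (le_trans (ler_piMr (expR_ge0 _) (sin_max _))) // (le_trans _ (hC t)) // ler_expR.
have h1 : 0 <= m^-1 ^+ 3 * (t ^+ 3 / 3) by rewrite mulr_ge0 ?divr_ge0 ?exprn_ge0.
have h2 : - q * m^-1 <= `|q0|.
  have h : - q <= `|q0| by have := ler_norm (- q0); rewrite normrN; lra.
  apply: le_trans (ler_wpM2r i0 h) _; exact: ler_piMr.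
have := ler_wpM2r t0 h2; rewrite (ger0_norm t0); lra.
Qed.

Lemma ray_int_bound q0 : exists2 C, 0 <= C &
  forall m q, 1 <= m -> q0 <= q -> `|ray_int m q| <= C.
Proof.
have [C C0 hC] := ray_profile_dominated q0.
exists (C * Rintegral mu setT (fun t : R => expR (- `|t|))).
  by rewrite mulr_ge0 //; apply: Rintegral_ge0 => t _; exact: expR_ge0.
move=> m q m1 hq.
exact: (exp_dominated_Rintegral mRy (@continuous_ray_profile m q) C0 (hC m q m1 hq)).
Qed.

Lemma Rintegral_ray_limit : Rintegral mu Ry (fun t =>
  expR (- (r ^+ 2 / 2 * t ^+ 2)) * sin (pi / 3 + k * (r ^+ 2 * t ^+ 2))) = Num.sqrt pi / 2 / r.
Proof.
pose f (t : R) := expR (- (t ^+ 2 / 2)) * sin (pi / 3 + k * t ^+ 2).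
have cf : continuous f by rewrite /f; deriv_continuous.
have [C C0 hC] := @expR_gauss_dominated R 0 (1 / 2) ltac:(lra).
have hf : exp_dominated Ry C f.
  move=> t _; apply: le_trans (hC t).
  rewrite /f normrM (ger0_norm (expR_ge0 _)) (le_trans (ler_piMr (expR_ge0 _) (sin_max _))) //.
  by rewrite ler_expR; lra.
have := Rintegral_scale_0y r_gt0 cf hf; rewrite {1}/f Rintegral_gauss_sin => ->.
rewrite [r * _]mulrC mulfK ?gt_eqF //; apply: eq_Rintegral => t _; rewrite /f.
by congr (expR _ * sin _); field.
Qed.

Lemma cvg_invS : (n.+1%:R : R)^-1 @[n --> \oo] --> (0 : R).
Proof. exact: cvg_harmonic. Qed.

Lemma cvg_ray_int (q_ : nat -> R) (q0 q1 : R) : (forall n, q0 <= q_ n <= q1) ->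
  ray_int n.+1%:R (q_ n) @[n --> \oo] --> Num.sqrt pi / 2 / r.
Proof.
move=> hq; rewrite -Rintegral_ray_limit.
have [C C0 hC] := ray_profile_dominated q0.
have qm : q_ n * n.+1%:R^-1 @[n --> \oo] --> (0 : R).
  apply: norm_cvg0.
  apply: (squeeze_cvgr (f := fun=> 0) (h := fun n : nat => (`|q0| + `|q1|) * n.+1%:R^-1)).
  - near=> n; rewrite normr_ge0 /= normrM (ger0_norm (_ : 0 <= n.+1%:R^-1)) //.
    rewrite ler_wpM2r //; have /andP[h1 h2] := hq n; rewrite ler_norml.
    have := ler_norm (- q0); have := ler_norm q1; have := normr_ge0 q0; have := normr_ge0 q1.
    by rewrite normrN => *; apply/andP; split; lra.
  - exact: cvg_cst.
  - by rewrite -(mulr0 (`|q0| + `|q1|)); apply: cvgM; [exact: cvg_cst|exact: cvg_invS].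
apply: (@cvg_Rintegral_exp_dominated R Ry C (fun n => ray_profile n.+1%:R (q_ n))) => //.
- by move=> n; apply: continuous_EFin_measurable => //; exact: continuous_ray_profile.
- by move=> n; apply: hC; rewrite ?ler1n //; have /andP[] := hq n.
- move=> t _; rewrite /ray_profile.
  have -> : expR (- (r ^+ 2 / 2 * t ^+ 2)) * sin (pi / 3 + k * (r ^+ 2 * t ^+ 2)) =
    expR (- (0 / 2 * t) - r ^+ 2 / 2 * t ^+ 2 - 0 ^+ 3 * (t ^+ 3 / 3)) *
    sin (pi / 3 + k * (r ^+ 2 * t ^+ 2 - 0 * t)).
    by congr (expR _ * sin _); field.
  apply: cvgM.
    apply: (cvg_comp _ expR); last exact: continuous_expR.
    apply: cvgB; last first.
      apply: cvgM; last exact: cvg_cst.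
      apply: (cvg_comp _ (fun x : R => x ^+ 3) cvg_invS); exact: exprn_continuous.
    apply: cvgB; last exact: cvg_cst.
    apply: cvgN; apply: cvgM; last exact: cvg_cst.
    by apply: cvgM; last exact: cvg_cst.
  apply: (cvg_comp _ sin); last exact: continuous_sin.
  apply: cvgD; first exact: cvg_cst.
  apply: cvgM; first exact: cvg_cst.
  apply: cvgB; first exact: cvg_cst.
  by apply: cvgM; last exact: cvg_cst.
Unshelve. all: by end_near. Qed.

(** Here [x = m^2], and the ray starts at [s = r^2 x], the square root of the leading part of
    [karg], hence an approximate saddle point. Then [s^3/3 - s u] gives the exponent of [prof] and
    [- r^6 x (y^2 + z^2)], which together with [2 r^6 x y z] from [kexp] is [- r^6 x (y - z)^2].
    Scaling [z - y] and the ray variable by [1/m] removes [x] from both Gaussians. *)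
Lemma kern_ray m y v : 1 <= m ->
  kern a r (m ^+ 2) y (y + v * m^-1) = m * prof (m ^+ 2) *
   (2 * r ^+ 4 / pi * expR (- (r ^+ 6 * v ^+ 2)) *
    ray_int m (r ^+ 4 * (y ^+ 2 + (y + v * m^-1) ^+ 2) + a / (4 * r ^+ 8))).
Proof.
move=> m1; have m0 : 0 < m by rewrite (lt_le_trans _ m1).
set z := y + v * m^-1; set q := r ^+ 4 * _ + _.
have im0 : 0 < m^-1 by rewrite invr_gt0.
have mN0 : m != 0 by rewrite gt_eqF.
have rN0 : r != 0 by rewrite gt_eqF.
have piN0 : pi != 0 :> R by rewrite gt_eqF ?pi_gt0.
pose s := r ^+ 2 * m ^+ 2; pose u := karg a r (m ^+ 2) y z.
have [C hC] := airy_ray_dominated (pi / 3) s u.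
rewrite /kern (Airy_ray s) -/u (Rintegral_scale_0y im0 (@continuous_airy_ray _ _ _ _) hC).
have qE : q = u - s ^+ 2 by rewrite /q /u /s /karg -/z; ring.
pose e0 := expR (- (2 * r ^+ 6) / 3 * (m ^+ 2) ^+ 3 - a / (2 * (2 * r ^+ 6)) * m ^+ 2).
(* Collects the factors independent of [t], so that they leave the integral at once. *)
pose c := (kexp r (m ^+ 2) y z)^-1 * (e0 * expR (- (r ^+ 6 * v ^+ 2))).
have kN0 : kexp r (m ^+ 2) y z != 0 by rewrite gt_eqF ?expR_gt0.
have pw t : airy_ray (pi / 3) s u (t * m^-1) = c * ray_profile m q t.
  apply: (mulfI kN0); rewrite /c -mulrA mulVKf // /kexp /airy_ray /e0 /ray_profile.
  rewrite !mulrA -!expRD; congr (expR _ * sin _).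
    have -> : u = q + s ^+ 2 by rewrite qE; ring.
    by rewrite /q /s /z; field; rewrite mN0 rN0.
  by rewrite qE /s; field.
have E1 : kexp r (m ^+ 2) y z * Rintegral mu Ry (fun t => airy_ray (pi / 3) s u (t * m^-1)) =
   e0 * expR (- (r ^+ 6 * v ^+ 2)) * ray_int m q.
  have [C' _ hC'] := ray_profile_dominated q.
  have I2 := exp_dominated_integrable mRy (@continuous_ray_profile m q) (hC' m q m1 (lexx q)).
  have -> : Rintegral mu Ry (fun t => airy_ray (pi / 3) s u (t * m^-1)) =
      Rintegral mu Ry (fun t => c * ray_profile m q t).
    by apply: eq_Rintegral => t _; exact: pw.
  by rewrite RintegralZl // [LHS]mulrA /c mulVKf.
transitivity (2 * r ^+ 4 * (pi^-1 * m^-1 * (kexp r (m ^+ 2) y z *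
  Rintegral mu Ry (fun t => airy_ray (pi / 3) s u (t * m^-1))))).
  by ring.
rewrite E1 /prof -/e0; move: piN0; generalize (pi : R) => p pN0.
by field; rewrite pN0 mN0.
Qed.

Variables (psi : R -> R) (B : R).
Hypothesis cpsi : continuous psi.
Hypothesis psiB : forall x, `|psi x| <= B.
Variable y : R.

Let q_ n v := r ^+ 4 * (y ^+ 2 + (y + v * n.+1%:R^-1) ^+ 2) + a / (4 * r ^+ 8).
(** With [m = n + 1], [x = m^2] and [z = y + v / m], this is the integrand of [kint] divided by
    [m prof x]. *)
Let W_ n v := psi (y + v * n.+1%:R^-1) *
  (2 * r ^+ 4 / pi * expR (- (r ^+ 6 * v ^+ 2)) * ray_int n.+1%:R (q_ n v)).

Let prof_gt0 x : 0 < x -> 0 < prof x.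
Proof. by move=> x0; rewrite mulr_gt0 ?expR_gt0 // invr_gt0. Qed.

Let mS n : 1 <= n.+1%:R :> R. Proof. by rewrite ler1n. Qed.

Let W_E n v : W_ n v = (n.+1%:R * prof (n.+1%:R ^+ 2))^-1 *
  (psi (y + v * n.+1%:R^-1) * kern a r (n.+1%:R ^+ 2) y (y + v * n.+1%:R^-1)).
Proof.
have h : n.+1%:R * prof (n.+1%:R ^+ 2) != 0.
  by rewrite gt_eqF // mulr_gt0 ?ltr0n // prof_gt0 // exprn_gt0 ?ltr0n.
by rewrite kern_ray // [psi _ * (_ * _)]mulrCA mulKf.
Qed.

(** [W_] contains a parameter integral; through [W_E] it becomes a composition of functions already
    known to be continuous. *)
Let continuous_W_ n : continuous (W_ n).
Proof.
have -> : W_ n = (fun v => (n.+1%:R * prof (n.+1%:R ^+ 2))^-1 *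
  (psi (y + v * n.+1%:R^-1) * kern a r (n.+1%:R ^+ 2) y (y + v * n.+1%:R^-1))).
  by apply/funext => v; exact: W_E.
move=> v; apply: cvgM; first exact: cvg_cst.
apply: cvgM; apply: (@continuous_comp _ _ _ (fun v => y + v * n.+1%:R^-1)).
- exact: continuous_affine.
- exact: cpsi.
- exact: continuous_affine.
- exact: continuous_kern.
Qed.

Let B0 : 0 <= B. Proof. exact: le_trans (normr_ge0 (psi 0)) (psiB 0). Qed.

Let W_dominated : exists C, forall n, exp_dominated setT C (W_ n).
Proof.
have [C C0 hC] := ray_int_bound (a / (4 * r ^+ 8)).
have r6 : 0 < r ^+ 6 by rewrite exprn_gt0.
have [C' C'0 hC'] := expR_gauss_dominated 0 r6.
have p0 : 0 <= 2 * r ^+ 4 / pi.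
  by rewrite divr_ge0 ?pi_ge0 // mulr_ge0 // exprn_ge0 // ltW.
exists (B * (2 * r ^+ 4 / pi * C' * C)) => n v _; rewrite /W_ normrM -[leRHS]mulrA.
apply: ler_pM => //; rewrite normrM normrM (ger0_norm p0) (ger0_norm (expR_ge0 _)).
have h1 : `|ray_int n.+1%:R (q_ n v)| <= C.
  by apply: hC => //; rewrite /q_ lerDr mulr_ge0 ?exprn_ge0 ?(ltW r_gt0) // addr_ge0 ?sqr_ge0.
have h2 : expR (- (r ^+ 6 * v ^+ 2)) <= C' * expR (- `|v|).
  by apply: le_trans (hC' v); rewrite ler_expR; lra.
apply: (@le_trans _ _ (2 * r ^+ 4 / pi * (C' * expR (- `|v|)) * C)); last first.
  by rewrite le_eqVlt; apply/orP; left; apply/eqP; ring.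
by apply: ler_pM => //; [rewrite mulr_ge0 ?expR_ge0|rewrite ler_wpM2l].
Qed.

Lemma Rintegral_gauss_scaled : Rintegral mu setT (fun v : R => expR (- (r ^+ 6 * v ^+ 2))) =
  Num.sqrt pi / r ^+ 3.
Proof.
have r3 : 0 < r ^+ 3 by rewrite exprn_gt0.
have [C C0 hC] := @expR_gauss_dominated R 0 1 ltr01.
have cg : continuous (fun t : R => expR (- t ^+ 2)) by deriv_continuous.
have hg : exp_dominated setT C (fun t : R => expR (- t ^+ 2)).
  by move=> t _; rewrite (ger0_norm (expR_ge0 _)) (le_trans _ (hC t)) // ler_expR; lra.
have := Rintegral_affine_T 0 r3 cg hg; rewrite Rintegral_gauss_T => ->.
rewrite [r ^+ 3 * _]mulrC mulfK ?gt_eqF //; apply: eq_Rintegral => t _.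
by congr expR; ring.
Qed.

Let cvg_W v : W_ n v @[n --> \oo] -->
  psi y * (2 * r ^+ 4 / pi * expR (- (r ^+ 6 * v ^+ 2)) * (Num.sqrt pi / 2 / r)).
Proof.
apply: cvgM.
  have h : y + v * n.+1%:R^-1 @[n --> \oo] --> y + v * 0.
    apply: cvgD; first exact: cvg_cst.
    by apply: cvgM; [exact: cvg_cst|exact: cvg_invS].
  by rewrite mulr0 addr0 in h; apply: (cvg_comp _ psi h); exact: cpsi.
apply: cvgM; first exact: cvg_cst.
apply: (@cvg_ray_int (fun n => q_ n v) (a / (4 * r ^+ 8))
  (r ^+ 4 * (y ^+ 2 + (`|y| + `|v|) ^+ 2) + a / (4 * r ^+ 8))) => n.
have r4 : 0 <= r ^+ 4 by rewrite exprn_ge0 // ltW.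
rewrite /q_ lerDr mulr_ge0 ?addr_ge0 ?sqr_ge0 //= lerD2r ler_wpM2l // lerD2l.
rewrite -real_normK ?num_real // lerXn2r ?nnegrE ?addr_ge0 //.
rewrite (le_trans (ler_normD _ _)) // lerD2l normrM ler_piMr //.
by rewrite ger0_norm // invf_le1 ?ltr0n.
Qed.

Let cvg_int_W : Rintegral mu setT (W_ n) @[n --> \oo] --> psi y.
Proof.
have [C hC] := W_dominated.
have := @cvg_Rintegral_exp_dominated R setT C W_ _ measurableT
  (fun n => continuous_EFin_measurable measurableT (@continuous_W_ n)) hC (fun v _ => @cvg_W v).
(* The ray contributes [sqrt pi / (2 r)] and the Gaussian in [v] contributes [sqrt pi / r^3]; with
   the prefactor [2 r^4 / pi] the product is 1. *)
suff -> : Rintegral mu setT (fun v => psi y * (2 * r ^+ 4 / pi * expR (- (r ^+ 6 * v ^+ 2)) *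
    (Num.sqrt pi / 2 / r))) = psi y by [].
have piN0 : pi != 0 :> R by rewrite gt_eqF ?pi_gt0.
have rN0 : r != 0 by rewrite gt_eqF.
pose c := psi y * (2 * r ^+ 4 / pi) * (Num.sqrt pi / 2 / r).
rewrite (@eq_Rintegral _ _ _ mu setT (fun v => c * expR (- (r ^+ 6 * v ^+ 2)))); last first.
  by move=> v _; rewrite /c; ring.
have r6 : 0 < r ^+ 6 by rewrite exprn_gt0.
have [C' C'0 hC'] := expR_gauss_dominated 0 r6.
rewrite RintegralZl //; last first.
  apply: (@exp_dominated_integrable _ _ C') => //; first by deriv_continuous.
  by move=> v _; rewrite (ger0_norm (expR_ge0 _)) (le_trans _ (hC' v)) // ler_expR; lra.
rewrite Rintegral_gauss_scaled /c.
have sp : Num.sqrt pi * Num.sqrt pi = pi :> R by rewrite -expr2 sqr_sqrtr ?pi_ge0.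
transitivity (psi y * (Num.sqrt pi * Num.sqrt pi) / pi); last by rewrite sp mulfK.
by move: piN0; generalize (pi : R) => p pN0; field; rewrite pN0 rN0.
Qed.

Lemma cvg_kint_prof :
  kint a r psi y (n.+1%:R ^+ 2) / prof (n.+1%:R ^+ 2) @[n --> \oo] --> psi y.
Proof.
have -> : (fun n => kint a r psi y (n.+1%:R ^+ 2) / prof (n.+1%:R ^+ 2)) =
    (fun n => Rintegral mu setT (W_ n)); last exact: cvg_int_W.
apply/funext => n; set m := n.+1%:R.
have m0 : 0 < m^-1 :> R by rewrite invr_gt0 ltr0n.
have mN0 : m != 0 :> R by rewrite gt_eqF ?ltr0n.
have pN0 : prof (m ^+ 2) != 0 by rewrite gt_eqF // prof_gt0 // exprn_gt0 ?ltr0n.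
have [C hC] := psi_kern_dominated a r_gt0 psiB `|m ^+ 2| y.
have cg : continuous (fun z => psi z * kern a r (m ^+ 2) y z).
  by move=> z; apply: cvgM; [exact: cpsi|exact: continuous_kern].
have [C' hC'] := W_dominated.
have IW := exp_dominated_integrable measurableT (@continuous_W_ n) (hC' n).
rewrite /kint (Rintegral_affine_T y m0 cg (hC _ (lexx _))).
rewrite (@eq_Rintegral _ _ _ mu setT (fun v => m * prof (m ^+ 2) * W_ n v)); last first.
  by move=> v _; rewrite W_E -/m mulVKf // mulf_neq0.
by rewrite RintegralZl // -[m * _ * _]mulrA mulKf // [prof _ * _]mulrC mulfK.
Qed.

End KernelAsymptotics.

(** * Uniqueness of the recessive solution *)

Section LinearODE.
Variable R : realType.
Implicit Types (W f g : R -> R) (x b X : R).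

(** The energy [f^2 + f1^2] has derivative [2 (1 + W) f f1], at least [- M] times itself. Weighted
    by [exp (M x)] it is nondecreasing, so its vanishing at [X] propagates to the left. *)
Lemma second_order_ode_backward_unique W f (f1 : R -> R) X b (M : R) :
  (forall x : R, is_derive x 1 f (f1 x)) ->
  (forall x : R, is_derive x 1 f1 (W x * f x)) ->
  (forall x, b <= x <= X -> `|1 + W x| <= M) ->
  b < X -> f X = 0 -> f1 X = 0 -> f b = 0.
Proof.
move=> hf hf1 hM bX fX f1X.
pose N x := (f x ^+ 2 + f1 x ^+ 2) * expR (M * x).
have dN (x : R) : is_derive x 1 N
   ((2 * (1 + W x) * (f x * f1 x) + M * (f x ^+ 2 + f1 x ^+ 2)) * expR (M * x)).
  rewrite /N; apply: is_derive_by; eexists; split.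
    notypeclasses refine (@is_derive_mulf _ (fun x => f x ^+ 2 + f1 x ^+ 2) _ _ _ _ _ _).
      notypeclasses refine (@is_derive_addf _ (fun x => f x ^+ 2) _ _ _ _ _ _).
        exact: is_derive_expf (hf x).
      exact: is_derive_expf (hf1 x).
    solve [repeat deriv_step].
  by rewrite /=; ring.
have [c /andP[bc cX] E] := is_derive_MVT dN bX.
have hc : `|1 + W c| <= M by apply: hM; rewrite !ltW.
have c0 : 0 <= 2 * (1 + W c) * (f c * f1 c) + M * (f c ^+ 2 + f1 c ^+ 2).
  have h1 : `|2 * (f c * f1 c)| <= f c ^+ 2 + f1 c ^+ 2.
    have := sqr_ge0 (f c - f1 c); have := sqr_ge0 (f c + f1 c).
    by rewrite ler_norml => *; apply/andP; split; lra.
  have h2 : `|(1 + W c) * (2 * (f c * f1 c))| <= M * (f c ^+ 2 + f1 c ^+ 2).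
    by rewrite normrM ler_pM.
  by move: h2; rewrite ler_norml => /andP[h2 _]; lra.
have : N b <= 0.
  have : 0 <= N X - N b by rewrite E mulr_ge0 ?subr_ge0 ?(ltW bX) // mulr_ge0 ?expR_ge0.
  by rewrite {1}/N fX f1X expr0n /= addr0 mul0r sub0r oppr_ge0.
rewrite /N pmulr_lle0 ?expR_gt0 // => h.
have : f b ^+ 2 <= 0 by apply: le_trans h; rewrite lerDl sqr_ge0.
by move=> h2; apply/eqP; rewrite -sqrf_eq0 eq_le h2 sqr_ge0.
Qed.

(* The quotient [f / g] has derivative [w / g^2] with [w] the Wronskian, so it
   grows at least linearly unless [w = 0]. *)
Lemma recessive_solution_unique W f (f1 : R -> R) g (g1 : R -> R) (X0 L : R) (x_ : nat -> R) :
  (forall x : R, is_derive x 1 f (f1 x)) ->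
  (forall x : R, is_derive x 1 f1 (W x * f x)) ->
  (forall x : R, is_derive x 1 g (g1 x)) ->
  (forall x : R, is_derive x 1 g1 (W x * g x)) ->
  (forall x, X0 <= x -> 0 < g x < 1) ->
  (x_ n @[n --> \oo] --> +oo%R) ->
  f (x_ n) / g (x_ n) @[n --> \oo] --> L ->
  forall x, X0 <= x -> f x = L * g x /\ f1 x = L * g1 x.
Proof.
move=> hf hf1 hg hg1 hgX hx hL.
pose w x := f1 x * g x - f x * g1 x.
have dw (x : R) : is_derive x 1 w 0.
  rewrite /w; apply: is_derive_by; eexists; split.
    notypeclasses refine (@is_derive_addf _ (fun x => f1 x * g x) (fun x => - (f x * g1 x)) _ _ _ _ _).
      exact: is_derive_mulf (hf1 x) (hg x).
    notypeclasses refine (@is_derive_oppf _ (fun x => f x * g1 x) _ _ _).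
    exact: is_derive_mulf (hf x) (hg1 x).
  by rewrite /=; ring.
have wE x : w x = w X0 by exact: is_derive_0_is_cst.
have gN0 x : X0 <= x -> g x != 0 by move=> /hgX/andP[h _]; rewrite gt_eqF.
have dq (x : R) : X0 <= x -> is_derive x 1 (fun x => f x / g x) (w X0 / g x ^+ 2).
  move=> Xx; have gx := gN0 x Xx.
  apply: is_derive_by; eexists; split.
    notypeclasses refine (@is_derive_mulf _ f (fun x => (g x)^-1) _ _ _ (hf x) _).
    exact: is_deriveV gx (hg x).
  rewrite -(wE x) /w /GRing.scale /=; field; exact: gx.
have mvt x x' : X0 <= x -> x < x' ->
    exists2 c, X0 <= c & f x' / g x' - f x / g x = w X0 / g c ^+ 2 * (x' - x).
  move=> Xx xx'; have [c||c hc E] := @MVT R (fun x => f x / g x) (fun x => w X0 / g x ^+ 2) x x' xx'.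
  - by rewrite in_itv /= => /andP[h _]; apply: dq; exact: le_trans Xx (ltW h).
  - apply: derivable_within_continuous => c; rewrite in_itv /= => /andP[h _].
    by case: (dq c (le_trans Xx h)).
  by exists c => //; move: hc; rewrite in_itv /= => /andP[h _]; exact: le_trans Xx (ltW h).
have w0 : w X0 = 0.
  apply/eqP; apply: contraT => wN0.
  have aw : 0 < `|w X0| by rewrite normr_gt0.
  (* From [0 < g < 1] the slope [w / g^2] is at least [|w|] in absolute value, against the
     boundedness of [f / g] along [x_]. *)
  have grow x : X0 < x -> `|w X0| * (x - X0) <= `|f x / g x| + `|f X0 / g X0|.
    move=> Xx; have [c Xc E] := mvt X0 x (lexx _) Xx.
    apply: le_trans (ler_normB _ _); rewrite E normrM [X in _ <= _ * X]ger0_norm ?subr_ge0 ?(ltW Xx) //.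
    rewrite ler_wpM2r ?subr_ge0 ?(ltW Xx) // normrM ler_peMr //.
    have /andP[g0 g1'] := hgX c Xc.
    by rewrite ger0_norm ?invr_ge0 ?sqr_ge0 // invf_ge1 ?exprn_gt0 // exprn_ile1 ?ltW.
  have n1 : \forall n \near \oo, `|f (x_ n) / g (x_ n)| < `|L| + 1.
    by apply: (cvgr_norm_lt L hL); rewrite ltrDl.
  have n2 : \forall n \near \oo,
      Num.max X0 (X0 + (`|L| + 1 + `|f X0 / g X0|) / `|w X0|) < x_ n.
    by move/cvgryPgt: hx; apply.
  have [n [h1 h2]] := @filter_ex _ _ _ _ (filterI n1 n2).
  move: h2; rewrite gt_max => /andP[h2 h3].
  have := grow _ h2; rewrite leNgt => /negP; case.
  move: h3; rewrite -ltrBrDl ltr_pdivrMr // => h3.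
  apply: (@lt_trans _ _ (`|L| + 1 + `|f X0 / g X0|)); first by rewrite ltrD2r.
  by rewrite [ltRHS]mulrC.
have qc x : X0 <= x -> f x / g x = f X0 / g X0.
  rewrite le_eqVlt => /orP[/eqP <- //|Xx].
  have [c _ E] := mvt X0 x (lexx _) Xx.
  by apply/eqP; rewrite -subr_eq0 E w0 !mul0r.
have LE : f X0 / g X0 = L.
  suff h : f (x_ n) / g (x_ n) @[n --> \oo] --> f X0 / g X0 by exact: (cvg_unique _ h hL).
  apply: cvg_near_cst; move/cvgryPge: hx => /(_ X0); apply: filterS => n h.
  exact: qc.
move=> x Xx; have gx := gN0 x Xx.
have fE : f x = L * g x by rewrite -LE -(qc x Xx) divfK.
split=> //; have := wE x; rewrite w0 /w fE => h; apply: (mulIf gx).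
by apply/eqP; rewrite -subr_eq0 -h; apply/eqP; ring.
Qed.

Lemma cvg0_bounded (f : R -> R) : continuous f ->
  (f x @[x --> +oo] --> (0 : R)) -> (f x @[x --> -oo] --> (0 : R)) ->
  exists B, forall x, `|f x| <= B.
Proof.
move=> cf hp hn.
have [b [_ hb]] := cvgr_norm_lt 0 hp 1 ltac:(by rewrite normr0).
have [d [_ hd]] := cvgr_norm_lt 0 hn 1 ltac:(by rewrite normr0).
pose T := Num.max `|b| `|d|.
have T0 : - T <= T by rewrite ge0_cp // le_max normr_ge0.
have cn : {within `[- T, T], continuous (fun x => `|f x|)}.
  apply: continuous_subspaceT => x; apply: (@continuous_comp _ _ _ f); first exact: cf.
  exact: norm_continuous.
have [c _ hc] := EVT_max T0 cn.
exists (Num.max 1 `|f c|) => x; rewrite le_max.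
have [Tx|xT] := ltP T x.
  apply/orP; left; apply/ltW/hb; apply: le_lt_trans (ler_norm b) _.
  by apply: le_lt_trans Tx; rewrite le_max lexx.
have [xT'|Tx'] := ltP x (- T).
  apply/orP; left; apply/ltW/hd; apply: lt_le_trans xT' _.
  by rewrite lerNl (le_trans (ler_norm _)) // normrN le_max lexx orbT.
by apply/orP; right; apply: hc; rewrite in_itv /= Tx' xT.
Qed.

End LinearODE.

(** * Removing the radicals in [lambda] *)

Section Reparametrization.
Variables (R : realType) (a lambda : R) (hlambda : 0 < lambda).

Lemma lambda_root : exists2 r : R, 0 < r &
  [/\ lambda `^ (3^-1) = 2 * r ^+ 4, lambda `^ (2 / 3) = 4 * r ^+ 8,
      lambda = 8 * r ^+ 12 & Num.sqrt (lambda / 2) = 2 * r ^+ 6].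
Proof.
pose c := lambda `^ (3^-1).
have c0 : 0 < c by exact: powR_gt0.
have c20 : 0 < c / 2 by rewrite divr_gt0.
(* The requirement [c = 2 r^4] makes [r] the fourth root of [c / 2]. *)
exists (Num.sqrt (Num.sqrt (c / 2))); first by rewrite !sqrtr_gt0.
set r := Num.sqrt _.
have r0 : 0 <= r by exact: sqrtr_ge0.
have r2 : r ^+ 2 = Num.sqrt (c / 2) by rewrite sqr_sqrtr ?sqrtr_ge0.
have r4 : r ^+ 4 = c / 2 by rewrite -[4%N]/(2 * 2)%N exprM r2 sqr_sqrtr // ltW.
have cE : c = 2 * r ^+ 4 by rewrite r4; field.
have c2 : lambda `^ (2 / 3) = 4 * r ^+ 8.
  rewrite mulrC powRrM -/c powR_mulrn ?(ltW c0) // cE.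
  by ring.
have c3 : lambda = 8 * r ^+ 12.
  have : (c `^ 3%:R) = lambda by rewrite /c -powRrM mulVf // powRr1 // ltW.
  by rewrite powR_mulrn ?(ltW c0) // cE => <-; ring.
split=> //; rewrite c3.
have -> : 8 * r ^+ 12 / 2 = (2 * r ^+ 6) ^+ 2 by field.
by rewrite sqrtr_sqr ger0_norm // mulr_ge0 // exprn_ge0.
Qed.

End Reparametrization.

(** * The product formula and the positivity of the kernel *)

Section ProductFormula.
Variables (R : realType) (a lambda : R) (hlambda : 0 < lambda).
Notation mu := (@lebesgue_measure R).

Lemma product_formula (E : R) (psi : R -> R) :
  normalized_eigenfunction a lambda E psi -> forall x y : R,
  mu.-integrable setT (fun z => (psi z * Kern a lambda x y z)%:E) /\
  psi x * psi y = Rintegral mu setT (fun z => psi z * Kern a lambda x y z).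
Proof.
move=> [hd1 [hd2 [hode [hp [hn [hprof _]]]]]] x y.
have [r r0 [l1 l2 l3 l4]] := lambda_root hlambda.
have KE w z : Kern a lambda w y z = kern a r w y z.
  rewrite /Kern /kern /kexp /karg l1 l2 l4 -mulrA; congr (_ * (expR _ * Airy _)); first by ring.
  by field; rewrite gt_eqF.
have fE : (fun z => psi z * Kern a lambda x y z) = (fun z => psi z * kern a r x y z).
  by apply/funext => z; rewrite KE.
have profE : asym_profile a lambda = prof a r by apply/funext => z; rewrite /asym_profile l4.
have d1 (z : R) : is_derive z 1 psi (derive1 psi z) by exact: derivable_is_derive1.
have d2 (z : R) : is_derive z 1 (derive1 psi) ((pot a r z - E) * psi z).
  apply: is_derive_by; eexists; split; first exact: derivable_is_derive1 (hd2 z).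
  have := hode z; rewrite /quartic_pot derive1nS derive1n1 /pot l3 => h.
  have -> : 4 * r ^+ 12 = 8 * r ^+ 12 / 2 by field.
  by rewrite mulrBl -h; ring.
have cpsi : continuous psi := continuous_psi d1.
have [B hB] := cvg0_bounded cpsi hp hn.
split.
  have := integrable_psi_kern a r0 d1 hB x y; apply: eq_integrable => // z _ /=.
  by rewrite KE.
rewrite fE -/(kint a r psi y x).
have dF := is_derive_kint a r0 d1 hB y.
have dF1 := is_derive_kint1 r0 d1 d2 hB y.
rewrite profE in hprof.
have e1 : \forall z \near +oo, 0 < psi z / prof a r z by exact: (cvgr_gt 1 hprof).
have e2 : \forall z \near +oo, `|psi z| < 1 by apply: (cvgr_norm_lt 0 hp); rewrite normr0.
(* Beyond [X0] the eigenfunction has the sign of [prof] and is below 1, as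
   [recessive_solution_unique] requires. These bounds hold strictly beyond [X0], hence the shift to
   [X0 + 1]. *)
have [X0 [_ hX0]] := filterI (filterI e1 e2) (nbhs_pinfty_gt (num_real (0 : R))).
have prof_gt0 z : 0 < z -> 0 < prof a r z.
  by move=> z0; rewrite mulr_gt0 ?expR_gt0 // invr_gt0.
have hg z : X0 + 1 <= z -> 0 < psi z < 1.
  move=> hz; have Xz : X0 < z by apply: lt_le_trans hz; rewrite ltrDl.
  have [[h1 h2] h3] := hX0 z Xz.
  have p0 := prof_gt0 z h3; move: h1; rewrite pmulr_lgt0 ?invr_gt0 // => h1.
  by rewrite h1 /=; move: h2; rewrite gtr0_norm.
have hx_ : (n.+1%:R ^+ 2 : R) @[n --> \oo] --> +oo%R.
  apply/cvgryPge => A; have := @cvgr_idn R => /cvgryPge/(_ A); apply: filterS => n /= h.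
  by rewrite (le_trans h) // -natrX ler_nat (leq_trans (leqnSn n)) // -mulnn leq_pmulr.
have hL : kint a r psi y (n.+1%:R ^+ 2) / psi (n.+1%:R ^+ 2) @[n --> \oo] --> psi y.
  have h1 := @cvg_kint_prof R a r r0 psi B cpsi hB y.
  have h2 : psi (n.+1%:R ^+ 2) / prof a r (n.+1%:R ^+ 2) @[n --> \oo] --> (1 : R).
    exact: (cvg_comp _ _ hx_ hprof).
  have h3 := cvgM h1 (cvgV (oner_neq0 R) h2); rewrite invr1 mulr1 in h3.
  have -> : (fun n : nat => kint a r psi y (n.+1%:R ^+ 2) / psi (n.+1%:R ^+ 2)) =
      (fun n : nat => kint a r psi y (n.+1%:R ^+ 2) / prof a r (n.+1%:R ^+ 2) *
        (psi (n.+1%:R ^+ 2) / prof a r (n.+1%:R ^+ 2))^-1).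
    apply/funext => n; rewrite invf_div mulrA divfK //.
    by rewrite gt_eqF // prof_gt0 // exprn_gt0 ?ltr0n.
  exact: h3.
have hu := recessive_solution_unique dF dF1 d1 d2 hg hx_ hL.
apply/esym/eqP; rewrite mulrC -subr_eq0; apply/eqP.
(* The difference solves the same linear equation and vanishes with its derivative on the right
   tail; backward uniqueness carries this to [x]. *)
pose D z := kint a r psi y z - psi y * psi z.
pose D1 z := kint1 a r psi y z - psi y * derive1 psi z.
rewrite -/(D x).
have dD (z : R) : is_derive z 1 D (D1 z).
  apply: is_derive_by; eexists; split.
    notypeclasses refine (@is_derive_addf _ _ (fun z => - (psi y * psi z)) _ _ _ (dF z) _).
    notypeclasses refine (@is_derive_oppf _ (fun z => psi y * psi z) _ _ _).
    notypeclasses refine (@is_derive_mulf _ (fun=> psi y) psi _ _ _ _ (d1 z)); deriv_step.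
  by rewrite /= /D1; ring.
have dD1 (z : R) : is_derive z 1 D1 ((pot a r z - E) * D z).
  apply: is_derive_by; eexists; split.
    notypeclasses refine (@is_derive_addf _ _ (fun z => - (psi y * derive1 psi z)) _ _ _ (dF1 z) _).
    notypeclasses refine (@is_derive_oppf _ (fun z => psi y * derive1 psi z) _ _ _).
    notypeclasses refine (@is_derive_mulf _ (fun=> psi y) (derive1 psi) _ _ _ _ (d2 z)); deriv_step.
  by rewrite /= /D; ring.
have D0 z : X0 + 1 <= z -> D z = 0 /\ D1 z = 0.
  by move=> /hu[h1 h2]; rewrite /D /D1 h1 h2 !subrr.
have [hx|hx] := leP (X0 + 1) x; first by have [] := D0 x hx.
(* A convenient bound for the coefficient of the equation on the interval from [x] to [X0 + 1],
   where [|z| <= |x| + |X0 + 1|]. *)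
have : tempered 0 (fun _ z => 1 + (pot a r z - E)) by rewrite /pot; repeat tempered_step.
move=> [P [N [P0 N0 hP]]].
have [DX D1X] := D0 _ (lexx _).
apply: (second_order_ode_backward_unique (M := P * expR (N * (`|x| + `|X0 + 1|))) dD dD1 _ hx DX D1X).
move=> z /andP[xz zX]; apply: le_trans (hP 0 z _) _; first by rewrite normr0.
rewrite ler_wpM2l // ler_expR ler_wpM2l // ler_norml.
have := ler_norm (- x); have := ler_norm (X0 + 1); have := normr_ge0 x; have := normr_ge0 (X0 + 1).
by rewrite normrN => *; apply/andP; split; lra.
Qed.

(** The squares can only increase the argument of [Airy], which is therefore at least
    [a / lambda^(2/3) > a1]. *)
Lemma Kern_gt0 (a1 : R) : Airy a1 = 0 -> (forall t : R, Airy t = 0 -> t <= a1) ->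
  lambda `^ (2 / 3) * a1 < a -> forall x y z : R, 0 < Kern a lambda x y z.
Proof.
move=> z1 hz ha x y z; rewrite /Kern.
have c0 : 0 < lambda `^ (3^-1) by exact: powR_gt0.
have c2 : 0 < lambda `^ (2 / 3) by exact: powR_gt0.
rewrite mulr_gt0 //; first by rewrite mulr_gt0 ?expR_gt0.
apply: (Airy_gt0 z1 hz); rewrite mulrC -ltr_pdivlMr // in ha.
apply: lt_le_trans ha _; rewrite lerDr mulr_ge0 ?divr_ge0 ?(ltW c0) //.
by rewrite !addr_ge0 ?sqr_ge0.
Qed.

End ProductFormula.

Unset Implicit Arguments.

Theorem theorem1 (R : realType) (a lambda : R) (hlambda : 0 < lambda) :
  (forall (E : R) (psi : R -> R),
     normalized_eigenfunction a lambda E psi ->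
     forall x y : R,
       lebesgue_measure.-integrable setT
         (fun z => (psi z * Kern a lambda x y z)%:E) /\
       psi x * psi y =
         Rintegral lebesgue_measure setT (fun z => psi z * Kern a lambda x y z))
  /\
  (forall a1 : R,
     Airy a1 = 0 -> (forall t : R, Airy t = 0 -> t <= a1) ->
     lambda `^ (2 / 3) * a1 < a ->
     forall x y z : R, 0 < Kern a lambda x y z).
Proof.
split; first exact: product_formula.
exact: Kern_gt0.
Qed.
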